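(* Let $\mathcal{G}$ be an infinite simple graph with bounded degree. For any $h\neq 0$, $\beta \geq 0$ and $N\in \mathbb{N}_{\geq 2}$ there are positive constants $c_0 = c_0 (\mathcal{G}, \beta,h, N)$ and $C_0 = C_0 (\mathcal{G}, \beta,h, N)$ such that the following holds. Let $(\mathcal{G}_L)_{L \in \mathbb{N}}$, with $\mathcal{G}_L = ( \mathcal{V}_L, \mathcal{E}_L)\subset \mathcal{G}$, be an arbitrary sequence of finite graphs. Then, for any $L \in \mathbb{N}$ and any $x, y \in \mathcal{V}_L$, $$\langle S^1_x S^1_y\rangle^{spin}_{\mathcal{G}_L,N,\beta,h} \leq C_0\, e^{-c_0 \, d_{\mathcal{G}}(x,y)},$$ where $d_{\mathcal{G}}(x,y)$ denotes the graph distance between $x$ and $y$ in $\mathcal{G}$. Moreover, the choice of $c_0$ can be made so that $c_0 = O(h^2)$ in the limit as $h \rightarrow 0$.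
   Context: Spin $O(N)$ model. For a finite simple graph $\mathcal{H}=(\mathcal{V},\mathcal{E})$ and $N\in\mathbb{N}_{>0}$ let $\Omega_{\mathcal{H},N}=(\mathbb{S}^{N-1})^{\mathcal{V}}$, where $\mathbb{S}^{N-1}\subset\mathbb{R}^N$ is the unit sphere. For $\beta\ge 0$ and $h\in\mathbb{R}$, the hamiltonian of $\varphi=(\varphi_x)_{x\in\mathcal{V}}\in\Omega_{\mathcal{H},N}$ is $$H^{spin}_{\mathcal{H},N,\beta,h}(\varphi)=-\beta\sum_{\{x,y\}\in\mathcal{E}}\varphi_x\cdot\varphi_y-h\sum_{x\in\mathcal{V}}\varphi_x^N,$$ where $\cdot$ is the usual inner product of $\mathbb{R}^N$, the first sum is over undirected edges, and $\varphi_x^i$ is the $i$-th component of $\varphi_x$. For $f:\Omega_{\mathcal{H},N}\to\mathbb{R}$, $$\langle f\rangle^{spin}_{\mathcal{H},N,\beta,h}=\frac{1}{Z^{spin}_{\mathcal{H},N,\beta,h}}\int_{\Omega_{\mathcal{H},N}}\mathrm{d}\varphi\, f(\varphi)\,e^{-H^{spin}_{\mathcal{H},N,\beta,h}(\varphi)},$$ where $\mathrm{d}\varphi=\prod_{x\in\mathcal{V}}\mathrm{d}\varphi_x$ with $\mathrm{d}\varphi_x$ the uniform measure on $\mathbb{S}^{N-1}$, and $Z^{spin}_{\mathcal{H},N,\beta,h}$ is the constant such that $\langle 1\rangle^{spin}_{\mathcal{H},N,\beta,h}=1$. For $x\in\mathcal{V}$, $S_x(\varphi):=\varphi_x$ is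 the spin at $x$, with components $S_x=(S_x^1,\dots,S_x^N)$. The notation $\mathcal{G}_L\subset\mathcal{G}$ means that $\mathcal{G}_L$ is a subgraph of $\mathcal{G}$. *)

(* Defs.v *)
From HB Require Import structures.
From mathcomp Require Export all_boot all_order all_algebra.
From mathcomp Require Export finmap.
From mathcomp Require Export all_classical all_reals all_analysis measurable_realfun.

Set Implicit Arguments.
Unset Strict Implicit.
Unset Printing Implicit Defensive.

Export Order.TTheory GRing.Theory Num.Theory.
Export numFieldNormedType.Exports.

Local Open Scope classical_set_scope.
Local Open Scope ring_scope.

Record sgraph (V : Type) := SGraph {
  adj :> rel V;
  adj_sym : symmetric adj;
  adj_irrefl : irreflexive adj }.

Definition bounded_degree (V : Type) (G : sgraph V) : Prop :=
  exists D : nat, forall x : V, ([set y | G x y] #<= `I_D)%card.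

(* Infimum of the lengths of the walks from x to y; it is +oo when x and y lie
   in different components of G. *)
Definition graph_dist (R : realType) (V : eqType) (G : sgraph V) (x y : V)
    : \bar R :=
  ereal_inf [set (size p)%:R%:E | p in [set p | path G x p /\ last x p = y]].

Record fin_subgraph (V : choiceType) (G : sgraph V) := FinSubgraph {
  verts : {fset V};
  subgr :> sgraph verts;
  subgr_sub : forall x y : verts, subgr x y -> G (val x) (val y) }.

Section product.
Context d (T : measurableType d) (R : realType).
Local Open Scope ereal_scope.

Definition consp n (z : T * n.-tuple T) : n.+1.-tuple T := cons_tuple z.1 z.2.

Lemma measurable_consp n : measurable_fun setT (@consp n).
Proof. exact: measurable_cons. Qed.

Section step.
Variables (m : {sigma_finite_measure set T -> \bar R}) (n : nat).
Variable mn : {sigma_finite_measure set (n.-tuple T) -> \bar R}.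

Definition mcons : set (n.+1.-tuple T) -> \bar R :=
  pushforward (m \x mn) (@consp n).

Let mcons0 : mcons set0 = 0.
Proof. by rewrite /mcons /pushforward preimage_set0 measure0. Qed.

Let mcons_ge0 A : 0 <= mcons A.
Proof. exact: (measure_ge0 (m \x mn)). Qed.

Let mcons_sigma_additive : semi_sigma_additive mcons.
Proof.
exact: (@measure_semi_sigma_additive _ _ _
  (measure_function_pushforward__canonical__measure_function_Measure
     (m \x mn) (@measurable_consp n))).
Qed.

HB.instance Definition _ := isMeasure.Build _ _ _ mcons
  mcons0 mcons_ge0 mcons_sigma_additive.

Let mcons_sigma_finite : sigma_finite setT mcons.
Proof.
have /sigma_finiteP[F [TF ndF Foo]] := sigma_finiteT m.
have /sigma_finiteP[G [TG ndG Goo]] := sigma_finiteT mn.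
pose g (t : n.+1.-tuple T) : T * n.-tuple T := (thead t, [tuple of behead t]).
have mg : measurable_fun setT g.
  apply/measurable_fun_pair; [exact: measurable_tnth|].
  exact: measurable_behead.
have gK : cancel (@consp n) g.
  move=> [x t]; rewrite /g /consp theadE /=; congr pair.
  by apply: val_inj.
exists (fun k => g @^-1` (F k `*` G k)).
  rewrite -preimage_bigcup [X in g @^-1` X](_ : _ = setT) ?preimage_setT//.
  rewrite -subTset => -[x y] _.
  have [i _ Fix] : (\bigcup_i F i) x by rewrite -TF.
  have [j _ Gjy] : (\bigcup_i G i) y by rewrite -TG.
  exists (maxn i j) => //; split.
  - by move: x Fix; exact/subsetPset/ndF/leq_maxl.
  - by move: y Gjy; exact/subsetPset/ndG/leq_maxr.
move=> k; have [mFk Fk] := Foo k; have [mGk Gk] := Goo k.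
have mFG : measurable (F k `*` G k) by exact: measurableX.
split; first by rewrite -[X in measurable X]setTI; exact: mg.
rewrite /mcons /pushforward -comp_preimage.
rewrite (_ : g \o _ = id); last by apply/funext => z /=; rewrite gK.
by rewrite preimage_id product_measure1E// lte_mul_pinfty// ge0_fin_numE.
Qed.

HB.instance Definition _ :=
  Measure_isSigmaFinite.Build _ _ _ mcons mcons_sigma_finite.

End step.

(* The n-fold product of m with itself, on n.-tuple T. *)
Fixpoint mtuple (m : {sigma_finite_measure set T -> \bar R}) (n : nat)
    : {sigma_finite_measure set (n.-tuple T) -> \bar R} :=
  match n with
  | 0%N => \d_ ([tuple] : 0.-tuple T)
  | n.+1 => mcons m (mtuple m n)
  end.

End product.

Section sphere.
Context (R : realType).

Definition dotp N (u v : N.-tuple R) : R := \sum_(i < N) tnth u i * tnth v i.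

Definition enorm N (u : N.-tuple R) : R := Num.sqrt (dotp u u).

(* Components are numbered from 1: u^i is [comp u i] for 1 <= i <= N. *)
Definition comp N (u : N.-tuple R) (i : nat) : R := nth 0 u i.-1.

Definition unit_sphere N : set (N.-tuple R) := [set u | enorm u = 1].
Arguments unit_sphere N : clear implicits.

(* lebesgue_measure lives on measurableTypeR R, which is R with a different
   display, so R^N is taken over measurableTypeR R as far as Lebesgue measure
   is concerned. *)
Notation RN N := (N.-tuple (measurableTypeR R)).

Definition lebesgueN N : {sigma_finite_measure set (RN N) -> \bar R} :=
  mtuple (@lebesgue_measure R) N.

Definition unit_ball N : set (RN N) := [set u | enorm (u : N.-tuple R) <= 1].
Arguments unit_ball N : clear implicits.

Definition normalize N (u : RN N) : N.-tuple R :=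
  [tuple tnth u i / enorm (u : N.-tuple R) | i < N].

Lemma measurable_coord N (i : 'I_N) :
  measurable_fun setT (fun u : RN N => tnth u i : R).
Proof. exact: (@measurable_tnth _ (measurableTypeR R)). Qed.

Lemma measurable_enorm N :
  measurable_fun setT (fun u : RN N => enorm (u : N.-tuple R)).
Proof.
apply: (measurableT_comp (continuous_measurable_fun (@sqrt_continuous R))).
apply: measurable_sum => i; apply: measurable_funM; exact: measurable_coord.
Qed.

Lemma measurable_unit_ball N : measurable (unit_ball N).
Proof.
rewrite (_ : unit_ball N = (fun u : RN N => enorm (u : N.-tuple R)) @^-1`
    `]-oo, 1]); first by rewrite -[X in measurable X]setTI; exact: measurable_enorm.
by apply/seteqP; split => u /=; rewrite in_itv.
Qed.

Lemma measurable_normalize N : measurable_fun setT (@normalize N).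
Proof.
apply/measurable_fun_tnthP => i.
rewrite (_ : _ \o _ = fun u : RN N => (tnth u i : R) / enorm (u : N.-tuple R));
  last by apply/funext => u /=; rewrite tnth_mktuple.
apply: measurable_funM; first exact: measurable_coord.
rewrite (_ : (fun x => _) = (fun a : R => a `^ (- 1)) \o
    (fun u : RN N => enorm (u : N.-tuple R))).
  by apply: measurableT_comp; [exact: measurable_powR|exact: measurable_enorm].
by apply/funext => u /=; rewrite powR_inv1// sqrtr_ge0.
Qed.

(* A |-> the Lebesgue measure of {u in the unit ball | u / |u| in A}, which is
   surface measure up to a constant factor. *)
Definition cone_measure N : set (N.-tuple R) -> \bar R :=
  pushforward (mrestr (lebesgueN N) (@measurable_unit_ball N)) (@normalize N).

Let cone_measure0 N : @cone_measure N set0 = 0%E.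
Proof. by rewrite /cone_measure /pushforward preimage_set0 measure0. Qed.

Let cone_measure_ge0 N A : (0 <= @cone_measure N A)%E.
Proof. exact: (measure_ge0 (mrestr _ _)). Qed.

Let cone_measure_sigma_additive N : semi_sigma_additive (@cone_measure N).
Proof.
exact: (@measure_semi_sigma_additive _ _ _
  (measure_function_pushforward__canonical__measure_function_Measure
     (mrestr (lebesgueN N) (@measurable_unit_ball N)) (@measurable_normalize N))).
Qed.

HB.instance Definition _ N := isMeasure.Build _ _ _ (@cone_measure N)
  (@cone_measure0 N) (@cone_measure_ge0 N) (@cone_measure_sigma_additive N).

(* The Dirac measure is the default value that mnormalize requires for measures
   of total mass 0 or +oo; it is not reached when N > 0. *)
Definition uniform_sphere N : probability (N.-tuple R) R :=
  mnormalize (@cone_measure N) \d_([tuple 0 | i < N] : N.-tuple R).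

End sphere.
Arguments unit_sphere R N : clear implicits.
Arguments uniform_sphere R N : clear implicits.

Section spin_model.
Context (R : realType) (V : finType) (H : sgraph V) (N : nat).

(* A configuration is stored along the enumeration of V. *)
Definition config := #|V|.-tuple (N.-tuple R).

Definition spin (phi : config) (x : V) : N.-tuple R := tnth phi (enum_rank x).

Definition Omega : set config := [set phi | forall x, unit_sphere R N (spin phi x)].

(* The factor 2^-1 is there because each undirected edge {x, y} occurs as (x, y)
   and as (y, x) in the double sum. *)
Definition hamiltonian (beta h : R) (phi : config) : R :=
  - beta * (2^-1 * \sum_x \sum_(y | H x y) dotp (spin phi x) (spin phi y))
  - h * \sum_x comp (spin phi x) N.

Definition config_measure : {sigma_finite_measure set config -> \bar R} :=
  mtuple (uniform_sphere R N) #|V|.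

Definition partition_function (beta h : R) : R :=
  \int[config_measure]_(phi in Omega) expR (- hamiltonian beta h phi).

Definition spin_expectation (beta h : R) (f : config -> R) : R :=
  (partition_function beta h)^-1 *
  \int[config_measure]_(phi in Omega) (f phi * expR (- hamiltonian beta h phi)).

End spin_model.
Arguments spin_expectation {R V} H N beta h f.
Arguments partition_function {R V} H N beta h.

(* Main.v *)
(** The Ward identities of the rotations in the plane of the first and last spin
components, applied to [S^1_x] and weighted by [th z = exp (c * d(x,z))], read
[h * \sum_z th z * <S^1_x S^1_z> = th x * <S^N_x>
  - beta * \sum_z \sum_(w ~ z) (th z - th w) * <S^1_x S^1_z S^N_w>].
Conditionally on all but the signs of the first components, these signs form a
ferromagnetic Ising model without field, so Griffiths' inequality gives
[`|<S^1_x S^1_z g>| <= <S^1_x S^1_z>] whenever [g] ignores these signs and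
[`|g| <= 1]; take [g = S^N_w].  Since [`|th z - th w| <= (expR c - 1) * th z] along
edges, for small [c] the last sum is absorbed by the left-hand side.  Truncating
the distance covers vertices in different components of the graph. *)

Require Import Defs.
From mathcomp Require Import ring lra.
Set Implicit Arguments.
Unset Strict Implicit.
Unset Printing Implicit Defensive.
Local Open Scope classical_set_scope.
Local Open Scope ring_scope.

(** * Measure-preserving maps *)

(** The uniform measure on the sphere is the central projection of Lebesgue measure on the ball, so
    its rotation invariance has to come from Lebesgue measure on tuples. The Ward identities are
    obtained without differentiating under the integral sign: rotating the single spin at [z] leaves
    every integral unchanged, its effect on observable and weight is expanded to first order with an
    explicit quadratic remainder, and small angles force the first-order term to integrate to zero.
    Conditioning on all but the signs is likewise replaced by averaging the integrand over all flips
    of first components. The final estimates see the finite graph only through its degrees, bounded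
    by [D], and through its edges, along which the distance of the ambient graph varies by at most
    1; hence constants that do not depend on the subgraph. *)

Definition preserves d (T : measurableType d) (R : realType)
    (mu : set T -> \bar R) (f : T -> T) : Prop :=
  measurable_fun setT f /\
  forall A, measurable A -> mu (f @^-1` A) = mu A.

Section preserves.
Context d (T : measurableType d) (R : realType).

Lemma preserves_id (mu : set T -> \bar R) : preserves mu id.
Proof. by split. Qed.

Lemma preserves_comp (mu : set T -> \bar R) f g :
  preserves mu f -> preserves mu g -> preserves mu (f \o g).
Proof.
move=> [mf muf] [mg mug]; split; first exact: measurableT_comp.
move=> A mA; rewrite comp_preimage mug ?muf//.
by rewrite -[X in measurable X]setTI; exact: mf.
Qed.

Lemma preserves_Rintegral (mu : {measure set T -> \bar R}) phi D (f : T -> R) :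
  preserves mu phi -> measurable D -> phi @^-1` D = D ->
  measurable_fun setT f -> mu.-integrable D (EFin \o f) ->
  mu.-integrable D (EFin \o (f \o phi)) /\
  \int[mu]_(x in D) f (phi x) = \int[mu]_(x in D) f x.
Proof.
move=> [mphi muphi] mD phiD mf intf.
have eqmu A : measurable A -> A `<=` D -> pushforward mu phi A = mu A.
  by move=> mA _; exact: muphi.
have mfD : measurable_fun D (EFin \o f) by exact: (measurable_int mu).
have intfp : mu.-integrable D (EFin \o (f \o phi)).
  apply/integrableP; split.
    by apply/measurable_EFinP/measurable_funTS; exact: measurableT_comp.
  move/integrableP : intf => [_].
  rewrite -(eq_measure_integral _ eqmu) ge0_integral_pushforward ?phiD//.
  exact: measurableT_comp.
split => //; congr fine.
rewrite -[RHS](eq_measure_integral _ eqmu).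
rewrite (@integral_pushforward _ _ _ _ _ phi mphi mu D (EFin \o f)) ?phiD//.
exact/measurable_EFinP.
Qed.

End preserves.

Section preserves_product.
Context d1 d2 (T1 : measurableType d1) (T2 : measurableType d2) (R : realType).
Variables (m1 : {sigma_finite_measure set T1 -> \bar R}).
Variables (m2 : {sigma_finite_measure set T2 -> \bar R}).

(** Fubini for sets: both iterated integrals agree on rectangles, which determine the measure.
    Sections can thus be taken along either factor. *)
Lemma product_measure12 A : measurable A ->
  (m1 \x m2)%E A = (m1 \x^ m2)%E A.
Proof.
move=> mA; apply: product_measure_unique => // B C mB mC.
exact: product_measure2E.
Qed.

(** The section at [x] of the preimage is the preimage of the section under [fun y => g (x, y)], so
    the integrands defining the two measures coincide. *)
Lemma preserves_skewr (g : T1 * T2 -> T2) : measurable_fun setT g ->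
  (forall x, preserves m2 (fun y => g (x, y))) ->
  preserves (m1 \x m2)%E (fun z => (z.1, g z)).
Proof.
move=> mg gP.
have mG : measurable_fun setT (fun z : T1 * T2 => (z.1, g z)).
  exact/measurable_fun_pair.
split=> // A mA; apply: eq_integral => x _ /=.
rewrite -[in RHS](proj2 (gP x)); last exact: measurable_xsection.
by congr (m2 _); apply/seteqP; split => y /=; rewrite /xsection /= !inE.
Qed.

Lemma preserves_skewl (g : T1 * T2 -> T1) : measurable_fun setT g ->
  (forall y, preserves m1 (fun x => g (x, y))) ->
  preserves (m1 \x m2)%E (fun z => (g z, z.2)).
Proof.
move=> mg gP.
have mG : measurable_fun setT (fun z : T1 * T2 => (g z, z.2)).
  exact/measurable_fun_pair.
split=> // A mA.
rewrite !product_measure12//; last first.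
  by rewrite -[X in measurable X]setTI; exact: mG.
apply: eq_integral => y _ /=.
rewrite -[in RHS](proj2 (gP y)); last exact: measurable_ysection.
by congr (m1 _); apply/seteqP; split => x /=; rewrite /ysection /= !inE.
Qed.

End preserves_product.

Section preserves_mtuple.
Context d (T : measurableType d) (R : realType).
Variable m : {sigma_finite_measure set T -> \bar R}.

(** [mtuple m n.+1] is the image of the product measure under [consp], which intertwines [F] and
    [f]; maps on tuples can thus be studied on head and tail. *)
Lemma preserves_mtuple_cons n (f : n.+1.-tuple T -> n.+1.-tuple T) F :
  preserves (m \x mtuple m n)%E F -> measurable_fun setT f ->
  (forall z, f (consp z) = consp (F z)) -> preserves (mtuple m n.+1) f.
Proof.
move=> [mF mnF] mf fF; split=> // A mA.
rewrite /= /mcons /pushforward -[in RHS]mnF; last first.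
  by rewrite -[X in measurable X]setTI; exact: measurable_consp.
set B := _ @^-1` _; suff -> : B = F @^-1` ((@consp _ T n) @^-1` A) by [].
by apply/seteqP; split => z; rewrite /B /= fF.
Qed.

Lemma preserves_mtuple n (f : 'I_n -> T -> T) :
  (forall i, preserves m (f i)) ->
  preserves (mtuple m n) (fun t => [tuple f i (tnth t i) | i < n]).
Proof.
elim: n f => [|n IH] f fm.
  split; first by apply/measurable_fun_tnthP => -[m' //].
  move=> A mA; set g := (fun t => _); suff -> : g = id by [].
  by apply/funext => t; rewrite tuple0 [RHS]tuple0.
have mt : measurable_fun setT
    (fun t : n.+1.-tuple T => [tuple f i (tnth t i) | i < n.+1]).
  apply/measurable_fun_tnthP => i.
  rewrite (_ : _ \o _ = f i \o (fun t => tnth t i)); last first.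
    by apply/funext => t /=; rewrite tnth_mktuple.
  by apply: measurableT_comp; [exact: (proj1 (fm i))|exact: measurable_tnth].
have IHn := IH (fun i => f (lift ord0 i)) (fun i => fm _).
apply: (@preserves_mtuple_cons _ _ ((fun z => (f ord0 z.1, z.2)) \o
   (fun z => (z.1, [tuple f (lift ord0 i) (tnth z.2 i) | i < n])))) => //.
- apply: preserves_comp.
    apply: preserves_skewl => [|y]; last exact: fm.
    by apply: measurableT_comp => //; exact: (proj1 (fm _)).
  apply: (@preserves_skewr _ _ _ _ _ _ _
    (fun z : T * n.-tuple T => [tuple f (lift ord0 i) (tnth z.2 i) | i < n])).
    by apply: (measurableT_comp (proj1 IHn)).
  by move=> x; exact: IHn.
- move=> [x t]; rewrite /consp /=; apply: eq_from_tnth => i.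
  rewrite tnth_mktuple.
  have [->|[j ->]] : i = ord0 \/ exists j, i = lift ord0 j.
  + by case: (unliftP ord0 i) => [j ->|->]; [right; exists j|left].
  + by rewrite !tnth0.
  + by rewrite !tnthS tnth_mktuple.
Qed.

Lemma mtuple_setT n : m setT = 1%E -> mtuple m n setT = 1%E.
Proof.
move=> m1; elim: n => [|n IH] /=; first by rewrite diracT.
rewrite /mcons /pushforward preimage_setT -setXTT product_measure1E//.
rewrite [X in (X * _)%E](_ : _ = 1%E); last exact: m1.
by rewrite mul1e; exact: IH.
Qed.

End preserves_mtuple.

(** * Rotations and reflections preserve Lebesgue measure *)

Section lebesgue.
Context (R : realType).
Notation leb := (@lebesgue_measure R).
Notation RM := (measurableTypeR R).

(** Half-open intervals determine Lebesgue measure; the measure compared with it is its image under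
    [f]. *)
Lemma preserves_lebesgue_ocitv (f : RM -> RM) : measurable_fun setT f ->
  (forall a b : R, leb (f @^-1` `]a, b]%classic) = leb (`]a, b]%classic)) ->
  preserves leb f.
Proof.
move=> mf H; split => // A mA; apply/esym.
apply: (@lebesgue_measure_unique _
  (measure_function_pushforward__canonical__measure_function_Measure leb mf)) => //.
by move=> _ [[a b] _ <-] /=; rewrite /pushforward H.
Qed.

Lemma preserves_translation (t : R) : preserves leb (fun x : RM => (x : R) + t : RM).
Proof.
apply: preserves_lebesgue_ocitv => [|a b].
  by apply: measurable_funD => //.
rewrite (_ : _ @^-1` _ = `](a - t), (b - t)]%classic); last first.
  by apply/seteqP; split=> x /=; rewrite !in_itv /= ltrBlDr lerBrDr.
rewrite !lebesgue_measure_itv /= !lte_fin ltrD2r.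
by case: ifP => // _; rewrite -!EFinB; congr EFin; ring.
Qed.

Lemma preserves_opp : preserves leb (fun x : RM => - (x : R) : RM).
Proof.
apply: preserves_lebesgue_ocitv => [|a b].
  exact: measurableT_comp.
rewrite (_ : _ @^-1` _ = `[(- b), (- a)[%classic); last first.
  by apply/seteqP; split=> x /=; rewrite !in_itv /= ltrNr lerNl andbC.
rewrite !lebesgue_measure_itv /= !lte_fin ltrN2.
by case: ifP => // _; rewrite -!EFinB; congr EFin; ring.
Qed.

End lebesgue.

Section isometries.
Context (R : realType).
Notation RN N := (N.-tuple (measurableTypeR R)).

(** The boolean makes the identity a member of the family, so that a map [V -> bool] encodes a
    choice of signs at all sites. *)
Definition flip1 N (e : bool) (t : N.-tuple R) : N.-tuple R :=
  [tuple (if (i == 0 :> nat) && e then - tnth t i else tnth t i) | i < N].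

Lemma preserves_flip1 N e : preserves (@lebesgueN R N) (@flip1 N e).
Proof.
apply: (@preserves_mtuple _ (measurableTypeR R) R (@lebesgue_measure R) N
  (fun i x => if (i == 0 :> nat) && e then - (x : R) else x)) => i.
case: (_ && e); [exact: preserves_opp|exact: preserves_id].
Qed.

(** With [n.+2] coordinates [ord0] and [ord_max] differ, so the added term does not involve the
    coordinate being changed. *)
Definition shear_first n (u : R) (t : n.+2.-tuple R) : n.+2.-tuple R :=
  [tuple (if i == ord0 then tnth t i + u * tnth t ord_max else tnth t i) | i < n.+2].

Definition shear_last n (u : R) (t : n.+2.-tuple R) : n.+2.-tuple R :=
  [tuple (if i == ord_max then tnth t i + u * tnth t ord0 else tnth t i) | i < n.+2].

Lemma measurable_shear_first n u :
  measurable_fun setT (@shear_first n u : RN n.+2 -> RN n.+2).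
Proof.
apply/measurable_fun_tnthP => i.
rewrite (_ : _ \o _ = fun t : RN n.+2 => if i == ord0 then
  (tnth t i : R) + u * (tnth t ord_max : R) else tnth t i); last first.
  by apply/funext => t /=; rewrite tnth_mktuple.
case: (i == ord0); last exact: measurable_coord.
apply: measurable_funD; first exact: measurable_coord.
by apply: measurable_funM => //; exact: measurable_coord.
Qed.

Lemma measurable_shear_last n u :
  measurable_fun setT (@shear_last n u : RN n.+2 -> RN n.+2).
Proof.
apply/measurable_fun_tnthP => i.
rewrite (_ : _ \o _ = fun t : RN n.+2 => if i == ord_max then
  (tnth t i : R) + u * (tnth t ord0 : R) else tnth t i); last first.
  by apply/funext => t /=; rewrite tnth_mktuple.
case: (i == ord_max); last exact: measurable_coord.
apply: measurable_funD; first exact: measurable_coord.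
by apply: measurable_funM => //; exact: measurable_coord.
Qed.

Lemma ord0_or_lift n (i : 'I_n.+1) : i = ord0 \/ exists j, i = lift ord0 j.
Proof. by case: (unliftP ord0 i) => [j ->|->]; [right; exists j|left]. Qed.

Lemma ord_max_lift n : (ord_max : 'I_n.+2) = lift ord0 (ord_max : 'I_n.+1).
Proof. exact: val_inj. Qed.

(** For a fixed tail this is a translation of the head by an amount that depends on the tail
    only. *)
Lemma preserves_shear_first n u :
  preserves (@lebesgueN R n.+2) (@shear_first n u).
Proof.
apply: (@preserves_mtuple_cons _ _ _ _ _ _
  (fun z : measurableTypeR R * RN n.+1 =>
     ((z.1 : R) + u * tnth z.2 ord_max : measurableTypeR R, z.2))).
- apply: (@preserves_skewl _ _ _ _ _ _ _ (fun z : measurableTypeR R * RN n.+1 =>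
     ((z.1 : R) + u * tnth z.2 ord_max : measurableTypeR R))).
    apply: measurable_funD => //; apply: measurable_funM => //.
    apply: (measurableT_comp (f := fun t : RN n.+1 => tnth t ord_max)) => //.
    exact: measurable_coord.
  by move=> y; exact: (preserves_translation (u * tnth y ord_max)).
- exact: measurable_shear_first.
- move=> [x t]; apply: eq_from_tnth => i; rewrite tnth_mktuple /consp /=.
  by case: (ord0_or_lift i) => [->|[j ->]]; rewrite ?tnth0 ?tnthS ?ord_max_lift ?tnthS.
Qed.

Lemma preserves_shear_last n u :
  preserves (@lebesgueN R n.+2) (@shear_last n u).
Proof.
pose tr (x : R) (t : RN n.+1) : RN n.+1 :=
  [tuple (if i == ord_max then (tnth t i : R) + u * x else tnth t i) | i < n.+1].
apply: (@preserves_mtuple_cons _ _ _ _ _ _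
  (fun z : measurableTypeR R * RN n.+1 => (z.1, tr z.1 z.2))).
- apply: (@preserves_skewr _ _ _ _ _ _ _ (fun z : measurableTypeR R * RN n.+1 =>
     tr z.1 z.2)).
    apply/measurable_fun_tnthP => i.
    rewrite (_ : _ \o _ = fun z : measurableTypeR R * RN n.+1 =>
      if i == ord_max then (tnth z.2 i : R) + u * (z.1 : R) else tnth z.2 i); last first.
      by apply/funext => t /=; rewrite tnth_mktuple.
    have mi : measurable_fun setT (fun z : measurableTypeR R * RN n.+1 => tnth z.2 i : R).
      apply: (measurableT_comp (f := fun t : RN n.+1 => tnth t i)) => //.
      exact: measurable_coord.
    by case: (i == ord_max) => //; apply: measurable_funD => //; apply: measurable_funM.
  move=> x; apply: (@preserves_mtuple _ (measurableTypeR R) R (@lebesgue_measure R) n.+1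
    (fun i y => if i == ord_max then (y : R) + u * x else y)) => i.
  by case: (i == ord_max); [exact: (preserves_translation (u * x))|exact: preserves_id].
- exact: measurable_shear_last.
- move=> [x t]; apply: eq_from_tnth => i; rewrite tnth_mktuple /consp /=.
  by case: (ord0_or_lift i) => [->|[j ->]]; rewrite ?tnth0 ?tnthS ?tnth_mktuple.
Qed.

(* Sine and cosine of [2 * atan u]; in terms of [u] the rotation is a product of
   three shears, which preserve Lebesgue measure by Fubini. *)
Definition rsin (u : R) : R := 2 * u / (1 + u ^+ 2).
Definition rcos (u : R) : R := 1 - u * rsin u.

Definition rot n (u : R) (t : n.+2.-tuple R) : n.+2.-tuple R :=
  [tuple (if i == ord0 then rcos u * tnth t ord0 - rsin u * tnth t ord_max
          else if i == ord_max then rsin u * tnth t ord0 + rcos u * tnth t ord_max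
          else tnth t i) | i < n.+2].

Lemma rsinE u : rsin u * (1 + u ^+ 2) = 2 * u.
Proof.
rewrite /rsin mulfVK//; apply: lt0r_neq0.
by rewrite (lt_le_trans (ltr01))// lerDl sqr_ge0.
Qed.

Lemma rcos2Drsin2 u : rcos u ^+ 2 + rsin u ^+ 2 = 1.
Proof.
have := rsinE u; rewrite /rcos; set s := rsin u => su.
have : s * (s * (1 + u ^+ 2) - 2 * u) = 0 by rewrite su subrr mulr0.
by move=> H; rewrite -[RHS]addr0 -H; ring.
Qed.

(** Here [u] is the tangent of half the angle, and the shear parameters are minus that tangent, the
    sine of the angle, and minus that tangent again. *)
Lemma rotE n u (t : n.+2.-tuple R) :
  rot u t = shear_first (- u) (shear_last (rsin u) (shear_first (- u) t)).
Proof.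
apply: eq_from_tnth => i; rewrite !tnth_mktuple.
have -> : (ord_max == ord0 :> 'I_n.+2) = false by [].
rewrite !eqxx /=; have su := rsinE u.
have [->|i0] := eqVneq i ord0.
  have -> : (ord0 == ord_max :> 'I_n.+2) = false by [].
  (* The corner entry requires [u * (1 + rcos u) = rsin u], which is [rsinE]; multiplying by the
     last coordinate makes the goal linear. *)
  have := congr1 (fun z => tnth t ord_max * z) su; rewrite /= /rcos => H; lra.
have [->|//] := eqVneq i ord_max.
by rewrite /rcos; ring.
Qed.

Lemma preserves_rot n u : preserves (@lebesgueN R n.+2) (@rot n u).
Proof.
have := preserves_comp (preserves_shear_first n (- u))
  (preserves_comp (preserves_shear_last n (rsin u)) (preserves_shear_first n (- u))).
by congr preserves; apply/funext => t; rewrite /= -rotE.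
Qed.

End isometries.

(** * Rotations and reflections preserve the uniform measure on the sphere *)

Section uniform.
Context (R : realType).

Definition homogeneous N (f : N.-tuple R -> N.-tuple R) : Prop :=
  forall (a : R) t, f [tuple tnth t i * a | i < N] = [tuple tnth (f t) i * a | i < N].

(** Homogeneity and invariance of the norm make [f] commute with [normalize] and respect the unit
    ball, so the invariance of Lebesgue measure passes to the cone measure. *)
Lemma preserves_uniform_sphere N (f : N.-tuple R -> N.-tuple R) :
  preserves (@lebesgueN R N) f -> homogeneous f ->
  (forall t, enorm (f t) = enorm t) -> preserves (uniform_sphere R N) f.
Proof.
move=> [mf lf] hf nf.
(* The fallback of [mnormalize] is the Dirac mass at the origin; homogeneity at scale 0 makes the
   origin a fixed point, so this mass is invariant too. *)
have f0 : f [tuple 0 | i < N] = [tuple 0 | i < N].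
  have := hf 0 [tuple 0 | i < N].
  rewrite (_ : [tuple _ | i < N] = [tuple 0 | i < N]); last first.
    by apply: eq_from_tnth => i; rewrite !tnth_mktuple mulr0.
  by move=> ->; apply: eq_from_tnth => i; rewrite !tnth_mktuple mulr0.
have mfR : measurable_fun setT (f : N.-tuple R -> N.-tuple R) by exact: mf.
have conef A : measurable A -> @cone_measure R N (f @^-1` A) = @cone_measure R N A.
  move=> mA.
  have mB : measurable (@normalize R N @^-1` A `&` @unit_ball R N).
    apply: measurableI; last exact: measurable_unit_ball.
    by rewrite -[X in measurable X]setTI; exact: measurable_normalize.
  rewrite /cone_measure /pushforward /mrestr -[RHS](lf _ mB).
  congr (lebesgueN _ _ _); apply/seteqP; split=> t /=.
    by rewrite /unit_ball /= nf /normalize hf nf.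
  by rewrite /unit_ball /= nf /normalize hf nf.
split=> // A mA.
rewrite /uniform_sphere /= /mnormalize.
case: ifP => _; last by congr (_ * _)%E; exact: conef.
have e : ([tuple 0 | i < N] \in f @^-1` A) = ([tuple 0 | i < N] \in A).
  by apply/idP/idP => /set_mem h; apply/mem_set; move: h; rewrite /preimage /= f0.
exact: (congr1 (fun b : bool => (b%:R : R)%:E) e).
Qed.

Lemma sum_first_last n (F : 'I_n.+2 -> R) :
  \sum_i F i = F ord0 + \sum_(i < n) F (lift ord0 (widen_ord (leqnSn n) i)) + F ord_max.
Proof.
rewrite big_ord_recl big_ord_recr /= addrA; congr (_ + _ + F _).
exact: val_inj.
Qed.

Lemma tnth_rot_mid n u (t : n.+2.-tuple R) (i : 'I_n) :
  tnth (rot u t) (lift ord0 (widen_ord (leqnSn n) i)) =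
  tnth t (lift ord0 (widen_ord (leqnSn n) i)).
Proof.
rewrite tnth_mktuple; case: eqP => [//|_]; case: eqP => [/(congr1 val)/= h|//].
by move: (ltn_ord i) h; rewrite /bump /= add1n => i_n [h]; rewrite h ltnn in i_n.
Qed.

Lemma tnth_rot_first n u (t : n.+2.-tuple R) :
  tnth (rot u t) ord0 = rcos u * tnth t ord0 - rsin u * tnth t ord_max.
Proof. by rewrite tnth_mktuple. Qed.

Lemma tnth_rot_last n u (t : n.+2.-tuple R) :
  tnth (rot u t) ord_max = rsin u * tnth t ord0 + rcos u * tnth t ord_max.
Proof. by rewrite tnth_mktuple eqxx. Qed.

Lemma dotp_rot n u (s t : n.+2.-tuple R) : dotp (rot u s) (rot u t) = dotp s t.
Proof.
rewrite /dotp !sum_first_last !tnth_rot_first !tnth_rot_last.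
under eq_bigr do rewrite !tnth_rot_mid.
set S := bigop _ _ _; have cs := rcos2Drsin2 u.
transitivity ((rcos u ^+ 2 + rsin u ^+ 2) * (tnth s ord0 * tnth t ord0)
  + S + (rcos u ^+ 2 + rsin u ^+ 2) * (tnth s ord_max * tnth t ord_max)).
  by ring.
by rewrite cs; ring.
Qed.

Lemma dotp_flip1 N e (s t : N.-tuple R) : dotp (flip1 e s) (flip1 e t) = dotp s t.
Proof.
by apply: eq_bigr => i _; rewrite !tnth_mktuple; case: ifP => _; rewrite ?mulrNN.
Qed.

Lemma preserves_uniform_sphere_rot n u : preserves (uniform_sphere R n.+2) (@rot R n u).
Proof.
apply: preserves_uniform_sphere.
- exact: preserves_rot.
- move=> a t; apply: eq_from_tnth => i; rewrite !tnth_mktuple.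
  by case: ifP => _; [ring|case: ifP => _ //; ring].
- by move=> t; rewrite /enorm dotp_rot.
Qed.

Lemma preserves_uniform_sphere_flip1 N e : preserves (uniform_sphere R N) (@flip1 R N e).
Proof.
apply: preserves_uniform_sphere.
- exact: preserves_flip1.
- move=> a t; apply: eq_from_tnth => i; rewrite !tnth_mktuple.
  by case: ifP => _ //; rewrite mulNr.
- by move=> t; rewrite /enorm dotp_flip1.
Qed.

End uniform.

(** * Griffiths' inequality *)

Section griffiths.
Context (R : realType) (V : finType) (a : V -> R).

Definition signed (sigma : {ffun V -> bool}) (v : V) : R := (-1) ^+ sigma v * a v.

(** All sequences are allowed, with repetitions: expanding a bond adds two sites to the sequence, so
    a statement about pairs alone would not survive the induction over bonds. *)
Definition moments_ge0 (F : {ffun V -> bool} -> R) : Prop :=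
  forall s : seq V, 0 <= \sum_sigma (\prod_(v <- s) signed sigma v) * F sigma.

(** The sum factorizes over the sites; a site occurring [k] times contributes
    [a v ^+ k + (- a v) ^+ k], which vanishes for odd [k] and is nonnegative for even [k]. *)
Lemma moments_ge0_1 : moments_ge0 (fun=> 1).
Proof.
move=> s; under eq_bigr do rewrite mulr1.
have prodE sigma : \prod_(v <- s) signed sigma v =
    \prod_v ((-1) ^+ sigma v * a v) ^+ count_mem v s.
  elim: s => [|v s IH]; first by rewrite big_nil big1.
  rewrite big_cons IH /= [RHS](bigD1 v)//= [in LHS](bigD1 v)//= eqxx exprS mulrA.
  congr (_ * _); apply: eq_bigr => w wv.
  by rewrite eq_sym (negPf wv).
rewrite (eq_bigr _ (fun sigma _ => prodE sigma)).
rewrite -(bigA_distr_bigA (fun v (e : bool) => ((-1) ^+ e * a v) ^+ count_mem v s)).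
apply: prodr_ge0 => v _; rewrite big_bool /= expr0 expr1 mul1r mulN1r.
set k := count_mem v s; have [ok|ek] := boolP (odd k).
  by rewrite exprNn -signr_odd ok expr1 mulN1r addNr.
by rewrite addr_ge0// exprn_even_ge0.
Qed.

(** Any function of one sign is affine in it. The coefficients are [cosh (J p)] and
    [sinh (J p) / p]; the latter is nonnegative because [sinh (J p)] never has the sign opposite to
    [p]. *)
Lemma expR_signed_product (J p : R) : 0 <= J -> exists C r : R,
  [/\ 0 <= C, 0 <= r & forall b : bool,
     expR (J * ((-1) ^+ b * p)) = C + r * ((-1) ^+ b * p)].
Proof.
move=> J0; have [->|p0] := eqVneq p 0.
  exists 1, 0; split=> // b.
  by rewrite !mulr0 expR0 addr0.
exists ((expR (J * p) + expR (- (J * p))) / 2), ((expR (J * p) - expR (- (J * p))) / (2 * p)).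
split.
- by rewrite divr_ge0// addr_ge0// expR_ge0.
- have [p_gt0|p_lt0|/eqP] := ltgtP 0 p; last by rewrite eq_sym (negPf p0).
    rewrite divr_ge0 ?mulr_ge0 ?(ltW p_gt0)// subr_ge0 ler_expR ge0_cp//.
    by rewrite mulr_ge0// ltW.
  rewrite -mulrNN -invrN mulr_ge0//.
    rewrite opprB subr_ge0 ler_expR.
    have : J * p <= 0 by rewrite mulr_ge0_le0// ltW.
    by lra.
  by rewrite invr_ge0 -mulrN mulr_ge0// oppr_ge0 ltW.
- by move=> [] /=; rewrite ?expr0 ?expr1 ?mul1r ?mulN1r ?mulrN; field.
Qed.

(** Expanding the bond factor leaves [C] times the moment along [s] plus [r] times the moment along
    [[:: v, w & s]]. *)
Lemma moments_ge0_expR F v w (J : R) : 0 <= J -> moments_ge0 F ->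
  moments_ge0 (fun sigma => F sigma * expR (J * (signed sigma v * signed sigma w))).
Proof.
move=> J0 F0 s.
have [C [r [C0 r0 Cr]]] := expR_signed_product (a v * a w) J0.
rewrite (eq_bigr (fun sigma => C * ((\prod_(v <- s) signed sigma v) * F sigma)
  + r * ((\prod_(v <- [:: v, w & s]) signed sigma v) * F sigma))); last first.
  move=> sigma _; rewrite !big_cons.
  have -> : signed sigma v * signed sigma w =
      (-1) ^+ (sigma v (+) sigma w) * (a v * a w).
    by rewrite /signed signr_addb; ring.
  rewrite Cr.
  have -> : forall x, signed sigma v * (signed sigma w * x) =
      (-1) ^+ (sigma v (+) sigma w) * (a v * a w) * x.
    by move=> x; rewrite /signed signr_addb; ring.
  by ring.
by rewrite big_split /= -!mulr_sumr addr_ge0// mulr_ge0.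
Qed.

(** Starting from independent signs, the bonds are added one at a time. *)
Lemma griffiths (J : V -> V -> R) (s : seq V) : (forall v w, 0 <= J v w) ->
  0 <= \sum_sigma (\prod_(v <- s) signed sigma v) *
    expR (\sum_v \sum_w J v w * (signed sigma v * signed sigma w)).
Proof.
move=> J0.
suff : moments_ge0 (fun sigma =>
  expR (\sum_v \sum_w J v w * (signed sigma v * signed sigma w))) by apply.
have -> : (fun sigma => expR (\sum_v \sum_w J v w * (signed sigma v * signed sigma w))) =
  (fun sigma => expR (\sum_(p <- index_enum (V * V)%type)
    J p.1 p.2 * (signed sigma p.1 * signed sigma p.2))).
  by apply/funext => sigma; rewrite pair_bigA.
elim: (index_enum _) => [|p l IH].
  have -> : (fun sigma => expR (\sum_(p <- [::]) J p.1 p.2 * (signed sigma p.1 * signed sigma p.2)))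
     = fun=> 1 by apply/funext => sigma; rewrite big_nil expR0.
  exact: moments_ge0_1.
have := moments_ge0_expR p.1 p.2 (J0 p.1 p.2) IH.
congr moments_ge0; apply/funext => sigma.
by rewrite big_cons addrC expRD.
Qed.

End griffiths.

(** * Integrals over configurations *)

Section configurations.
Context (R : realType) (V : finType) (N : nat).
Implicit Types (phi : config R V N) (f g : config R V N -> R).
Local Notation Omega := (@Omega R V N).
Local Notation mu := (config_measure R V N).

Definition on_sites (T : V -> N.-tuple R -> N.-tuple R) phi : config R V N :=
  [tuple T (enum_val i) (tnth phi i) | i < #|V|].

Lemma spin_on_sites T phi v : spin (on_sites T phi) v = T v (spin phi v).
Proof. by rewrite /spin tnth_mktuple enum_rankK. Qed.

Lemma preserves_on_sites T : (forall v, preserves (uniform_sphere R N) (T v)) ->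
  preserves mu (on_sites T).
Proof.
by move=> H; apply: (@preserves_mtuple _ _ R _ #|V| (fun i => T (enum_val i))).
Qed.

Lemma on_sites_Omega T : (forall v t, enorm (T v t) = enorm t) ->
  on_sites T @^-1` Omega = Omega.
Proof.
move=> H; apply/seteqP; split=> phi O v; have := O v;
  by rewrite /unit_sphere /= spin_on_sites H.
Qed.

Lemma measurable_spin v i :
  measurable_fun setT (fun phi => tnth (spin phi v) i).
Proof.
apply: (measurableT_comp (f := fun t : N.-tuple R => tnth t i)).
  exact: measurable_tnth.
exact: measurable_tnth.
Qed.

Lemma measurable_Omega : measurable Omega.
Proof.
have -> : Omega = \bigcap_(v in setT) ((fun phi => enorm (spin phi v)) @^-1` [set 1]).
  by apply/seteqP; split => [phi O v _|phi O v]; exact: O.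
apply: fin_bigcap_measurable => [|v _]; first exact: finite_finset.
have mv : measurable_fun setT (fun phi => enorm (spin phi v)).
  apply: (measurableT_comp (continuous_measurable_fun (@sqrt_continuous R))).
  by apply: measurable_sum => i; apply: measurable_funM; exact: measurable_spin.
by rewrite -[X in measurable X]setTI; exact: mv.
Qed.

Lemma mu_setT : mu setT = 1%E.
Proof. apply: mtuple_setT; exact: probability_setT. Qed.

(** The bound is asked on [Omega] only, since spin components are unbounded elsewhere. The class is
    closed under the operations used below, and its members are integrable because the total mass is
    1. *)
Definition bmeasurable f : Prop := measurable_fun setT f /\
  exists K, forall phi, Omega phi -> `|f phi| <= K.

Lemma bmeas_integrable f : bmeasurable f -> mu.-integrable Omega (EFin \o f).
Proof.
move=> [mf [K fK]]; apply: measurable_bounded_integrable.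
- exact: measurable_Omega.
- apply: (le_lt_trans (y := mu setT)).
    by apply: le_measure; rewrite ?inE//; exact: measurable_Omega.
  by rewrite mu_setT ltry.
- exact: measurable_funTS.
- exists K; split; first exact: num_real.
  by move=> x Kx phi /fK /le_trans; apply; exact: ltW.
Qed.

Lemma bmeas_cst c : bmeasurable (fun=> c).
Proof. by split => //; exists `|c|. Qed.

Lemma bmeas_add f g : bmeasurable f -> bmeasurable g -> bmeasurable (fun phi => f phi + g phi).
Proof.
move=> [mf [K fK]] [mg [L gL]]; split; first exact: measurable_funD.
exists (K + L) => phi O.
by rewrite (le_trans (ler_normD _ _))// lerD ?fK ?gL.
Qed.

Lemma bmeas_mul f g : bmeasurable f -> bmeasurable g -> bmeasurable (fun phi => f phi * g phi).
Proof.
move=> [mf [K fK]] [mg [L gL]]; split; first exact: measurable_funM.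
exists (K * L) => phi O.
by rewrite normrM ler_pM ?fK ?gL.
Qed.

Lemma bmeas_opp f : bmeasurable f -> bmeasurable (fun phi => - f phi).
Proof.
move=> /(bmeas_mul (bmeas_cst (-1))); congr bmeasurable.
by apply/funext => phi; rewrite mulN1r.
Qed.

Lemma bmeas_sum (I : Type) (r : seq I) (P : pred I) (F : I -> config R V N -> R) :
  (forall i, P i -> bmeasurable (F i)) -> bmeasurable (fun phi => \sum_(i <- r | P i) F i phi).
Proof.
move=> H; elim: r => [|i r IH].
  by under eq_fun do rewrite big_nil; exact: bmeas_cst.
under eq_fun do rewrite big_cons.
case Pi: (P i) => //; exact: bmeas_add (H _ Pi) IH.
Qed.

Lemma bmeas_expR f : bmeasurable f -> bmeasurable (fun phi => expR (f phi)).
Proof.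
move=> [mf [K fK]]; split; first exact: measurableT_comp.
exists (expR K) => phi O.
by rewrite ger0_norm ?expR_ge0// ler_expR (le_trans (ler_norm _))// fK.
Qed.

Lemma Omega_le1 phi v i : Omega phi -> `|tnth (spin phi v) i| <= 1.
Proof.
move=> O; have e1 : enorm (spin phi v) = 1 by exact: O.
rewrite -e1 -sqrtr_sqr ler_wsqrtr// /dotp (bigD1 i)//= -expr2 lerDl.
by apply: sumr_ge0 => j _; rewrite -expr2 sqr_ge0.
Qed.

Lemma bmeas_spin v i : bmeasurable (fun phi => tnth (spin phi v) i).
Proof.
split; first exact: measurable_spin.
by exists 1 => phi; exact: Omega_le1.
Qed.

Lemma bmeas_dotp v w : bmeasurable (fun phi => dotp (spin phi v) (spin phi w)).
Proof. by apply: bmeas_sum => i _; apply: bmeas_mul; exact: bmeas_spin. Qed.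

Lemma bmeas_on_sites T f : (forall v, preserves (uniform_sphere R N) (T v)) ->
  (forall v t, enorm (T v t) = enorm t) -> bmeasurable f -> bmeasurable (f \o on_sites T).
Proof.
move=> mT nT [mf [K fK]]; split.
  apply: measurableT_comp => //; exact: (proj1 (preserves_on_sites mT)).
by exists K => phi O; apply: fK; rewrite -(on_sites_Omega nT) in O.
Qed.

Definition config_integral f : R := \int[mu]_(phi in Omega) f phi.

Lemma integral_on_sites T f : (forall v, preserves (uniform_sphere R N) (T v)) ->
  (forall v t, enorm (T v t) = enorm t) -> bmeasurable f ->
  config_integral (f \o on_sites T) = config_integral f.
Proof.
move=> mT nT nf.
by have [] := @preserves_Rintegral _ _ _ mu _ Omega f (preserves_on_sites mT)
   measurable_Omega (on_sites_Omega nT) (proj1 nf) (bmeas_integrable nf).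
Qed.

Lemma integral_add f g : bmeasurable f -> bmeasurable g ->
  config_integral (fun phi => f phi + g phi) = config_integral f + config_integral g.
Proof.
move=> nf ng; apply: RintegralD; first exact: measurable_Omega.
  exact: bmeas_integrable.
exact: bmeas_integrable.
Qed.

Lemma integralZ c f : bmeasurable f ->
  config_integral (fun phi => c * f phi) = c * config_integral f.
Proof.
by move=> nf; apply: RintegralZl; [exact: measurable_Omega|exact: bmeas_integrable].
Qed.

Lemma integral_sum (I : Type) (r : seq I) (P : pred I) (F : I -> config R V N -> R) :
  (forall i, P i -> bmeasurable (F i)) ->
  config_integral (fun phi => \sum_(i <- r | P i) F i phi) =
  \sum_(i <- r | P i) config_integral (F i).
Proof.
move=> H; elim: r => [|i r IH].
  rewrite big_nil; under eq_fun do rewrite big_nil.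
  by have := integralZ 0 (bmeas_cst 0); rewrite !mul0r.
rewrite big_cons; under eq_fun do rewrite big_cons.
case Pi: (P i) => //; rewrite integral_add ?IH//; first exact: H.
exact: bmeas_sum.
Qed.

Lemma eq_integral_Omega f g : (forall phi, Omega phi -> f phi = g phi) ->
  config_integral f = config_integral g.
Proof. by move=> fg; apply: eq_Rintegral => phi /set_mem/fg. Qed.

Lemma le_integral_Omega f g : bmeasurable f -> bmeasurable g ->
  (forall phi, Omega phi -> f phi <= g phi) -> config_integral f <= config_integral g.
Proof.
move=> nf ng fg; apply: le_Rintegral => //; first exact: measurable_Omega.
  exact: bmeas_integrable.
exact: bmeas_integrable.
Qed.

Lemma integral_ge0_Omega f : (forall phi, Omega phi -> 0 <= f phi) -> 0 <= config_integral f.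
Proof. exact: Rintegral_ge0. Qed.

Lemma norm_integral_le f c : bmeasurable f -> (forall phi, Omega phi -> `|f phi| <= c) ->
  `|config_integral f| <= c * fine (mu Omega).
Proof.
move=> nf fc; apply: (le_trans (le_normr_Rintegral measurable_Omega (bmeas_integrable nf))).
rewrite -(Rintegral_cst _ measurable_Omega); apply: le_integral_Omega => //; last exact: bmeas_cst.
split; first by apply: measurableT_comp => //; exact: (proj1 nf).
by exists c => phi O; rewrite normr_id fc.
Qed.

Definition flips (sigma : {ffun V -> bool}) : config R V N -> config R V N :=
  on_sites (fun v => flip1 (sigma v)).

(** By invariance all flipped copies of [f] have the same integral, so the integral of the flip sum
    is that of [f] times the number of sign choices. *)
Lemma integral_ge0_flips f : bmeasurable f ->
  (forall phi, Omega phi -> 0 <= \sum_sigma f (flips sigma phi)) -> 0 <= config_integral f.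
Proof.
move=> nf f0.
have nT (sigma : {ffun V -> bool}) : forall v t, enorm (@flip1 R N (sigma v) t) = enorm t.
  by move=> v t; rewrite /enorm dotp_flip1.
have mT (sigma : {ffun V -> bool}) v := @preserves_uniform_sphere_flip1 R N (sigma v).
have : 0 <= \sum_(sigma : {ffun V -> bool}) config_integral f.
  rewrite (eq_bigr (fun sigma => config_integral (f \o flips sigma))); last first.
    by move=> sigma _; rewrite integral_on_sites.
  rewrite -integral_sum; first exact: integral_ge0_Omega.
  by move=> sigma _; apply: bmeas_on_sites.
rewrite sumr_const pmulrn_lge0// card_ffun.
by rewrite card_bool expn_gt0.
Qed.

End configurations.

(** * Second-order estimates for small rotations *)

Section taylor.
Context (R : realType).

Lemma expR_quadratic (x : R) : `|x| <= 1 / 2 ->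
  0 <= expR x - 1 - x <= 2 * x ^+ 2.
Proof.
move=> x2; have /andP[xl xr] : - (1 / 2) <= x <= 1 / 2 by rewrite -ler_norml.
have e1 := expR_ge1Dx x; have e2 := expR_ge1Dx (- x).
have e3 : expR x * expR (- x) = 1 by rewrite expRxMexpNx_1.
apply/andP; split; first by lra.
(* This is [1 - x <= expR (- x)] multiplied by [expR x]. *)
have : expR x * (1 - x) <= 1.
  by rewrite -[leRHS]e3 ler_wpM2l ?expR_ge0.
move=> e4.
have : (expR x - 1 - x - 2 * x ^+ 2) * (1 - x) <= 0.
  rewrite (_ : _ * _ = (expR x * (1 - x) - 1) + x ^+ 2 * (2 * x - 1)); last by ring.
  have : x ^+ 2 * (2 * x - 1) <= 0 by rewrite mulr_ge0_le0 ?sqr_ge0//; lra.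
  by lra.
have x1 : 0 < 1 - x by lra.
by rewrite pmulr_lle0// => ?; lra.
Qed.

(** [F], [D] and [p] describe a rotated observable, [al] and [ga] the change of the exponent; [s]
    stands for a sine and [k] for a cosine minus one. The 18 collects 1 from [k * p], 1 from
    [F * (k * ga)], 8 from the remainder of the exponential and 8 from the product of the two
    increments. The condition [4 * B * s <= 1] keeps the exponent within 1/2. *)
Lemma rotated_weight_taylor (B F D p al ga s k : R) : 1 <= B ->
  `|F| <= 1 -> `|D| <= 1 -> `|p| <= 1 -> `|al| <= B -> `|ga| <= B ->
  0 < s -> 4 * B * s <= 1 -> `|k| <= s ^+ 2 ->
  `|(F + s * D + k * p) * expR (s * al + k * ga) - F - s * (D + F * al)|
    <= 18 * B ^+ 2 * s ^+ 2.
Proof.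
move=> B1 F1 D1 p1 alB gaB s0 sB ks.
set d := s * al + k * ga.
have s1 : s <= 1 by nra.
have dB : `|d| <= 2 * B * s.
  rewrite (le_trans (ler_normD _ _))// !normrM (gtr0_norm s0).
  have h1 : s * `|al| <= s * B by rewrite ler_wpM2l// ltW.
  have h2 : `|k| * `|ga| <= s ^+ 2 * B by rewrite ler_pM.
  have h3 : s ^+ 2 * B <= s * B by rewrite expr2 -mulrA ler_piMl// mulr_ge0//; lra.
  by lra.
have /andP[r0 rd] : 0 <= expR d - 1 - d <= 2 * d ^+ 2.
  by apply: expR_quadratic; rewrite (le_trans dB)//; lra.
set r := expR d - 1 - d in r0 rd.
have rB : r <= 8 * B ^+ 2 * s ^+ 2.
  rewrite (le_trans rd)// -real_normK ?num_real//.
  have -> : 8 * B ^+ 2 * s ^+ 2 = 2 * (2 * B * s) ^+ 2 by ring.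
  by rewrite ler_pM2l// lerXn2r// nnegrE ?normr_ge0 //; nra.
have -> : expR d = 1 + d + r by rewrite /r; ring.
have -> : (F + s * D + k * p) * (1 + d + r) - F - s * (D + F * al) =
  k * p + F * (k * ga) + F * r + (s * D + k * p) * (d + r) by rewrite /d; ring.
clearbody r; clearbody d.
have n1 : `|k * p| <= s ^+ 2.
  by rewrite normrM -[leRHS]mulr1 ler_pM.
have n2 : `|F * (k * ga)| <= s ^+ 2 * B.
  by rewrite !normrM -[leRHS]mul1r !ler_pM// mulr_ge0.
have n3 : `|F * r| <= 8 * B ^+ 2 * s ^+ 2.
  by rewrite normrM -[leRHS]mul1r ler_pM// ger0_norm.
have n4 : `|s * D + k * p| <= 2 * s.
  rewrite (le_trans (ler_normD _ _))//.
  have : `|s * D| <= s by rewrite normrM gtr0_norm// ler_piMr// ltW.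
  have : s ^+ 2 <= s by nra.
  by lra.
have n5 : `|d + r| <= 4 * B * s.
  rewrite (le_trans (ler_normD _ _))// (ger0_norm r0).
  have : 8 * B ^+ 2 * s ^+ 2 <= 2 * B * s.
    have -> : 8 * B ^+ 2 * s ^+ 2 = 2 * B * s * (4 * B * s) by ring.
    by rewrite ler_piMr// !mulr_ge0//; lra.
  by lra.
have n6 : `|(s * D + k * p) * (d + r)| <= 8 * B * s ^+ 2.
  rewrite normrM (le_trans (ler_pM _ _ n4 n5))//.
  by have -> : 2 * s * (4 * B * s) = 8 * B * s ^+ 2 by ring.
have s2 : 0 <= s ^+ 2 by exact: sqr_ge0.
have b1 : s ^+ 2 <= B ^+ 2 * s ^+ 2 by rewrite ler_peMl// expr_ge1//; lra.
have b2 : s ^+ 2 * B <= B ^+ 2 * s ^+ 2.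
  by rewrite mulrC ler_wpM2r// expr2 ler_peMl//; lra.
have := ler_normD (k * p + F * (k * ga) + F * r) ((s * D + k * p) * (d + r)).
have := ler_normD (k * p + F * (k * ga)) (F * r).
have := ler_normD (k * p) (F * (k * ga)).
by lra.
Qed.

(** The sine serves as expansion parameter: [1 - rcos u = u * rsin u], and [u <= rsin u] because
    [1 + u ^+ 2 <= 2]. *)
Lemma rsin_bounds (u : R) : 0 < u <= 1 ->
  [/\ 0 < rsin u, rsin u <= 2 * u & `|rcos u - 1| <= rsin u ^+ 2].
Proof.
move=> /andP[u0 u1]; have su := rsinE u.
have w : 0 < 1 + u ^+ 2 by rewrite ltr_pwDl// sqr_ge0.
have s0 : 0 < rsin u by rewrite /rsin divr_gt0// mulr_gt0.
have us : u <= rsin u.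
  have : u ^+ 2 <= 1 by rewrite expr_le1// ltW.
  by nra.
split=> //.
  by rewrite -su ler_peMr ?(ltW s0)// lerDl sqr_ge0.
rewrite /rcos -addrA addrC -addrA addNr addr0 normrN ger0_norm; last first.
  exact: (mulr_ge0 (ltW u0) (ltW s0)).
by rewrite expr2 ler_wpM2r// ltW.
Qed.

End taylor.

(** * Ward identities *)

Section model.
Context (R : realType) (V : finType) (H : sgraph V) (n : nat) (beta h : R).
Implicit Types (phi : config R V n.+2) (f g : config R V n.+2 -> R).

Definition S1 phi v : R := tnth (spin phi v) ord0.
Definition SN phi v : R := tnth (spin phi v) ord_max.

Lemma comp_first (t : n.+2.-tuple R) : comp t 1 = tnth t ord0.
Proof. by rewrite /comp (tnth_nth 0). Qed.

Lemma comp_last (t : n.+2.-tuple R) : comp t n.+2 = tnth t ord_max.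
Proof. by rewrite /comp (tnth_nth 0). Qed.

Definition weight phi : R := expR (- hamiltonian H beta h phi).

Definition coupling v w : R := beta / 2 * (H v w)%:R.

Lemma oppr_hamiltonian phi : - hamiltonian H beta h phi =
  \sum_v \sum_w coupling v w * dotp (spin phi v) (spin phi w) + h * \sum_v SN phi v.
Proof.
rewrite /hamiltonian opprD opprK mulNr opprK; congr (_ + _ * _).
  rewrite mulrA mulr_sumr; apply: eq_bigr => v _.
  rewrite mulr_sumr big_mkcond /=; apply: eq_bigr => w _.
  by rewrite /coupling; case: (H v w); rewrite ?mulr1 ?mulr0 ?mul0r.
by apply: eq_bigr => v _; rewrite comp_last.
Qed.

Lemma bmeas_weight : bmeasurable weight.
Proof.
apply: bmeas_expR; rewrite (_ : (fun phi => _) = (fun phi => 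
  \sum_v \sum_w coupling v w * dotp (spin phi v) (spin phi w) + h * \sum_v SN phi v)).
  apply: bmeas_add.
    apply: bmeas_sum => v _; apply: bmeas_sum => w _.
    by apply: bmeas_mul; [exact: bmeas_cst|exact: bmeas_dotp].
  apply: bmeas_mul; first exact: bmeas_cst.
  by apply: bmeas_sum => v _; exact: bmeas_spin.
by apply/funext => phi; exact: oppr_hamiltonian.
Qed.

Lemma weight_ge0 phi : 0 <= weight phi. Proof. exact: expR_ge0. Qed.

Definition gibbs_integral f : R := config_integral (fun phi => f phi * weight phi).

Lemma bmeas_mul_weight f : bmeasurable f -> bmeasurable (fun phi => f phi * weight phi).
Proof. by move=> nf; apply: bmeas_mul => //; exact: bmeas_weight. Qed.

Definition dotp_tail (t s : n.+2.-tuple R) : R :=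
  \sum_(i < n.+1) tnth t (lift ord0 i) * tnth s (lift ord0 i).

Lemma dotp_tailE t s : dotp t s = tnth t ord0 * tnth s ord0 + dotp_tail t s.
Proof. by rewrite /dotp big_ord_recl. Qed.

Lemma dotp_tail_flip1 (e e' : bool) (t s : n.+2.-tuple R) :
  dotp_tail (flip1 e t) (flip1 e' s) = dotp_tail t s.
Proof. by apply: eq_bigr => i _; rewrite !tnth_mktuple. Qed.

Lemma S1_flips sigma phi v : S1 (flips sigma phi) v = signed (S1 phi) sigma v.
Proof.
rewrite /S1 /flips spin_on_sites tnth_mktuple /= /signed.
by case: (sigma v); rewrite ?expr0 ?expr1 ?mul1r ?mulN1r.
Qed.

Lemma SN_flips sigma phi v : SN (flips sigma phi) v = SN phi v.
Proof. by rewrite /SN /flips spin_on_sites tnth_mktuple. Qed.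

Lemma gibbs_S1S1_ge0 x y g : 0 <= beta -> bmeasurable g ->
  (forall phi, Omega phi -> 0 <= g phi) ->
  (forall sigma phi, g (flips sigma phi) = g phi) ->
  0 <= gibbs_integral (fun phi => S1 phi x * S1 phi y * g phi).
Proof.
move=> beta0 ng g0 gflips; apply: integral_ge0_flips.
  apply: bmeas_mul_weight; apply: bmeas_mul => //.
  by apply: bmeas_mul; exact: bmeas_spin.
move=> phi O.
(* Everything in the exponent that the flips fix; the field belongs here because it acts on the last
   component only. *)
pose rest := \sum_v \sum_w coupling v w * dotp_tail (spin phi v) (spin phi w)
  + h * \sum_v SN phi v.
rewrite (eq_bigr (fun sigma => g phi * expR rest *
   ((\prod_(v <- [:: x; y]) signed (S1 phi) sigma v) *
    expR (\sum_v \sum_w coupling v w *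
      (signed (S1 phi) sigma v * signed (S1 phi) sigma w))))); last first.
  move=> sigma _; rewrite !S1_flips gflips !big_cons big_nil mulr1.
  rewrite /weight oppr_hamiltonian.
  have -> : \sum_v \sum_w coupling v w *
      dotp (spin (flips sigma phi) v) (spin (flips sigma phi) w) =
    \sum_v \sum_w coupling v w * (signed (S1 phi) sigma v * signed (S1 phi) sigma w) +
    \sum_v \sum_w coupling v w * dotp_tail (spin phi v) (spin phi w).
    rewrite -big_split; apply: eq_bigr => v _; rewrite -big_split; apply: eq_bigr => w _.
    rewrite dotp_tailE -/(S1 _ _) -/(S1 _ _) !S1_flips mulrDr; congr (_ + _ * _).
    by rewrite /flips !spin_on_sites dotp_tail_flip1.
  under [X in h * X]eq_bigr do rewrite SN_flips.
  by rewrite -addrA expRD -/rest; ring.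
rewrite -mulr_sumr mulr_ge0//; first by rewrite mulr_ge0 ?expR_ge0 ?g0.
apply: griffiths => v w; rewrite /coupling mulr_ge0// divr_ge0//.
Qed.

(** Rotating one site at a time gives one identity for each [z], so that arbitrary weights can be
    put on the sites later. *)
Definition rotated z (u : R) : config R V n.+2 -> config R V n.+2 :=
  on_sites (fun v => if v == z then rot u else id).

(** The derivative at angle 0 of [- hamiltonian] under the rotation at [z]; [radial] is the
    coefficient of [rcos u - 1]. *)
Definition angular z phi : R :=
  h * S1 phi z + beta * \sum_(w | H z w) (S1 phi z * SN phi w - SN phi z * S1 phi w).

Definition radial z phi : R :=
  h * SN phi z + beta * \sum_(w | H z w) (S1 phi z * S1 phi w + SN phi z * SN phi w).

(** Rotating the spin at [z] changes only the bonds at [z]. Each is counted in both orders, and the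
    resulting 2 cancels the 1/2 in [coupling]. *)
Lemma sum_star (z : V) (t : V -> V -> R) :
  (forall v w, t v w = t w v) -> t z z = 0 ->
  (forall v w, v != z -> w != z -> t v w = 0) ->
  \sum_v \sum_w t v w = 2 * \sum_w t z w.
Proof.
move=> tC tz t0; rewrite (bigD1 z)//= mulr2n mulrDl mul1r; congr (_ + _).
rewrite [RHS](bigD1 z)//= tz add0r; apply: eq_bigr => v vz.
rewrite (bigD1 z)//= tC big1 ?addr0// => w wz; exact: t0.
Qed.

(** The identity is exact: no edge joins [z] to itself, so the exponent is affine in the spin at
    [z]. *)
Lemma hamiltonian_rotated z u phi : - hamiltonian H beta h (rotated z u phi) =
  - hamiltonian H beta h phi +
  (rsin u * angular z phi + (rcos u - 1) * radial z phi).
Proof.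
apply/eqP; rewrite addrC -subr_eq; apply/eqP.
have spinz : spin (rotated z u phi) z = rot u (spin phi z).
  by rewrite spin_on_sites eqxx.
have spinv v : v != z -> spin (rotated z u phi) v = spin phi v.
  by move=> /negPf vz; rewrite spin_on_sites vz.
rewrite !oppr_hamiltonian opprD addrACA -mulrBr -!sumrB.
under eq_bigr do (rewrite -sumrB; under eq_bigr do rewrite -mulrBr).
rewrite (@sum_star z); first last.
- by move=> v w vz wz; rewrite !spinv// subrr mulr0.
- by rewrite /coupling adj_irrefl mulr0 mul0r.
- move=> v w; rewrite /coupling adj_sym; congr (_ * (_ - _)).
    by apply: eq_bigr => i _; rewrite mulrC.
  by apply: eq_bigr => i _; rewrite mulrC.
have -> : \sum_v (SN (rotated z u phi) v - SN phi v) = SN (rotated z u phi) z - SN phi z.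
  rewrite (bigD1 z)//= big1 ?addr0// => v vz.
  by rewrite /SN spinv// subrr.
have -> : SN (rotated z u phi) z = rsin u * S1 phi z + rcos u * SN phi z.
  by rewrite /SN spinz tnth_rot_last.
have -> : 2 * (\sum_w coupling z w * (dotp (spin (rotated z u phi) z) (spin (rotated z u phi) w) -
    dotp (spin phi z) (spin phi w))) =
  beta * \sum_(w | H z w) (rsin u * (S1 phi z * SN phi w - SN phi z * S1 phi w) +
     (rcos u - 1) * (S1 phi z * S1 phi w + SN phi z * SN phi w)).
  rewrite mulr_sumr [X in _ * X]big_mkcond /= mulr_sumr.
  apply: eq_bigr => w _; rewrite /coupling; case: ifP => zw; last first.
    by rewrite !mulr0 mul0r mulr0.
  have wz : w != z by apply/eqP => wz; rewrite wz adj_irrefl in zw.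
  rewrite spinz spinv// /dotp !sum_first_last tnth_rot_first tnth_rot_last.
  under eq_bigr do rewrite tnth_rot_mid.
  by rewrite -!/(S1 _ _) -!/(SN _ _) mulr1; field.
rewrite big_split /= -!mulr_sumr /angular /radial; ring.
Qed.

Lemma bmeas_S1 v : bmeasurable (fun phi => S1 phi v). Proof. exact: bmeas_spin. Qed.

Lemma bmeas_SN v : bmeasurable (fun phi => SN phi v). Proof. exact: bmeas_spin. Qed.

Lemma bmeas_angular z : bmeasurable (angular z).
Proof.
have nS := bmeas_S1.
have nN := bmeas_SN.
apply: bmeas_add; first by apply: bmeas_mul; [exact: bmeas_cst|].
apply: bmeas_mul; first exact: bmeas_cst.
apply: bmeas_sum => w _; apply: bmeas_add; first exact: bmeas_mul.
by apply: bmeas_opp; exact: bmeas_mul.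
Qed.

Lemma bmeas_radial z : bmeasurable (radial z).
Proof.
have nS := bmeas_S1.
have nN := bmeas_SN.
apply: bmeas_add; first by apply: bmeas_mul; [exact: bmeas_cst|].
apply: bmeas_mul; first exact: bmeas_cst.
by apply: bmeas_sum => w _; apply: bmeas_add; exact: bmeas_mul.
Qed.

Lemma integral_rotated z u f : bmeasurable f ->
  bmeasurable (f \o rotated z u) /\ config_integral (f \o rotated z u) = config_integral f.
Proof.
move=> nf.
have mT v : preserves (uniform_sphere R n.+2) (if v == z then rot u else id).
  by case: (v == z); [exact: preserves_uniform_sphere_rot|exact: preserves_id].
have nT v (t : n.+2.-tuple R) : enorm ((if v == z then rot u else id) t) = enorm t.
  by case: (v == z) => //; rewrite /enorm dotp_rot.
by split; [exact: bmeas_on_sites|exact: integral_on_sites].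
Qed.

(** Invariance cancels [f] against its rotated copy, so [rsin u] times the integral of [E] is of
    order [rsin u ^+ 2]; dividing by [rsin u] and taking [u] small leaves 0. *)
Lemma integral_generator z f E (B C : R) : bmeasurable f -> bmeasurable E -> 1 <= B -> 0 <= C ->
  (forall u phi, 0 < u <= 1 -> 4 * B * rsin u <= 1 -> Omega phi ->
    `|f (rotated z u phi) - f phi - rsin u * E phi| <= C * rsin u ^+ 2) ->
  config_integral E = 0.
Proof.
move=> nf nE B1 C0 fE.
have [K [K0 key]] : exists K, 0 <= K /\ forall u, 0 < u <= 1 -> 4 * B * rsin u <= 1 ->
    `|config_integral E| <= K * rsin u.
  exists (C * fine (config_measure R V n.+2 (@Omega R V n.+2))); split.
    by rewrite mulr_ge0// fine_ge0// measure_ge0.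
  move=> u u01 uB; have [s0 _ _] := rsin_bounds u01.
  have [nfr Ifr] := integral_rotated z u nf.
  have nopp g : bmeasurable g -> bmeasurable (fun phi => -1 * g phi).
    exact: bmeas_mul (bmeas_cst _ _ _).
  have nsE : bmeasurable (fun phi => - rsin u * E phi) by exact: bmeas_mul (bmeas_cst _ _ _) nE.
  have nfrf : bmeasurable (fun phi => (f \o rotated z u) phi + -1 * f phi).
    exact: bmeas_add nfr (nopp _ nf).
  have := @norm_integral_le _ _ _ _ (C * rsin u ^+ 2) (bmeas_add nfrf nsE).
  rewrite (integral_add nfrf nsE) (integral_add nfr (nopp _ nf)) Ifr.
  rewrite (integralZ _ nf) (integralZ _ nE) mulN1r subrr add0r mulNr normrN.
  rewrite normrM (gtr0_norm s0) => H1.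
  rewrite -(ler_pM2l s0) (le_trans (H1 _))//; last first.
    by rewrite le_eqVlt; apply/orP; left; apply/eqP; ring.
  move=> phi O; rewrite mulN1r mulNr; exact: fE.
apply/eqP; rewrite -normr_le0 leNgt; apply/negP => I0.
clear fE nf nE; set I := `|config_integral E| in key I0; clearbody I.
(* A positive [I] is refuted at [u = I / den]: the term [8 * B * I] makes the angle admissible,
   [4 * K] yields the contradiction [I <= 2 * K * u < I], and 1 keeps [den] positive. *)
pose den : R := 8 * B * I + 4 * K + 1.
have BI : 0 <= 8 * B * I by rewrite !mulr_ge0//; lra.
have den0 : 0 < den by rewrite /den; lra.
pose u := I / den.
have u0 : 0 < u by rewrite divr_gt0.
have uden : u * den = I by rewrite /u divfK ?gt_eqF.
have uB : 8 * B * u <= 1.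
  by rewrite /u mulrA ler_pdivrMr// mul1r /den; lra.
have u1 : u <= 1.
  rewrite /u ler_pdivrMr// mul1r /den.
  have : I <= B * I by rewrite ler_peMl// ltW.
  by lra.
have [|s0 s2u _] := @rsin_bounds R u; first by rewrite u0.
have sB : 4 * B * rsin u <= 1.
  rewrite (le_trans _ uB)// (_ : 8 * B * u = 4 * B * (2 * u)); last by ring.
  by rewrite ler_wpM2l// mulr_ge0//; lra.
have := key u; rewrite u0 u1 => /(_ isT sB) Iu.
have KE : K * rsin u <= K * (2 * u) by rewrite ler_wpM2l.
have h1 : 0 <= u * (8 * B * I) by rewrite mulr_ge0// ltW.
have h2 : 0 <= u * K by rewrite mulr_ge0// ltW.
have e : u * den = u * (8 * B * I) + 4 * (u * K) + u by rewrite /den; ring.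
by lra.
Qed.

(** The right-hand side has the shape [F + s * D + k * p] of [rotated_weight_taylor]. *)
Lemma S1_rotated x z u phi : S1 (rotated z u phi) x =
  S1 phi x + rsin u * - ((x == z)%:R * SN phi x) +
  (rcos u - 1) * ((x == z)%:R * S1 phi x).
Proof.
rewrite /S1 spin_on_sites; case: eqP => [_|_] /=.
  by rewrite tnth_rot_first -/(SN _ _); ring.
by rewrite !mul0r oppr0 !mulr0 !addr0.
Qed.

Lemma norm_S1_le1 phi v : Omega phi -> `|S1 phi v| <= 1.
Proof. exact: Omega_le1. Qed.

Lemma norm_SN_le1 phi v : Omega phi -> `|SN phi v| <= 1.
Proof. exact: Omega_le1. Qed.

(** The derivative of [S1 x * weight] under the rotation at [z], divided by [weight]. *)
Definition rotation_derivative x z phi : R :=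
  - ((x == z)%:R * SN phi x) + S1 phi x * angular z phi.

Lemma bmeas_rotation_derivative x z : bmeasurable (rotation_derivative x z).
Proof.
apply: bmeas_add; first apply: bmeas_opp; apply: bmeas_mul.
- exact: bmeas_cst.
- exact: bmeas_SN.
- exact: bmeas_S1.
- exact: bmeas_angular.
Qed.

Lemma gibbs_rotation_derivative x z : gibbs_integral (rotation_derivative x z) = 0.
Proof.
have [_ [Ka Kalpha]] := bmeas_angular z.
have [_ [Kg Kgamma]] := bmeas_radial z.
have [_ [Kw Kweight]] := bmeas_weight.
have [B [B1 BKa BKg]] : exists B, [/\ 1 <= B, Ka <= B & Kg <= B].
  exists (1 + `|Ka| + `|Kg|).
  have := ler_norm Ka; have := ler_norm Kg; have := normr_ge0 Ka; have := normr_ge0 Kg.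
  by split; lra.
have B2 : 0 <= 18 * B ^+ 2 by rewrite mulr_ge0// sqr_ge0.
apply: (@integral_generator z (fun phi => S1 phi x * weight phi) _ B (18 * B ^+ 2 * `|Kw|)).
- exact: bmeas_mul_weight (bmeas_S1 x).
- exact: bmeas_mul_weight (bmeas_rotation_derivative x z).
- exact: B1.
- exact: mulr_ge0.
move=> u phi u01 uB O; have [s0 _ cs] := rsin_bounds u01.
rewrite {1}/weight hamiltonian_rotated expRD S1_rotated -/(weight phi) /rotation_derivative.
set s := rsin u; set k := rcos u - 1; set al := angular z phi; set ga := radial z phi.
set D := - (_ * SN phi x); set p := _ * S1 phi x.
have -> : (S1 phi x + s * D + k * p) * (weight phi * expR (s * al + k * ga)) -
   S1 phi x * weight phi - s * ((D + S1 phi x * al) * weight phi) =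
   ((S1 phi x + s * D + k * p) * expR (s * al + k * ga) - S1 phi x - s * (D + S1 phi x * al))
   * weight phi by ring.
rewrite normrM (_ : _ * _ * s ^+ 2 = 18 * B ^+ 2 * s ^+ 2 * `|Kw|); last by ring.
apply: ler_pM; [exact: normr_ge0|exact: normr_ge0| |]; last first.
  exact: le_trans (Kweight _ O) (ler_norm _).
have bool_le1 (b : bool) (y : R) : `|y| <= 1 -> `|b%:R * y| <= 1.
  by case: b; rewrite ?mul1r ?mul0r ?normr0.
apply: rotated_weight_taylor.
- exact: B1.
- exact: norm_S1_le1.
- by rewrite normrN; apply: bool_le1; exact: norm_SN_le1.
- by apply: bool_le1; exact: norm_S1_le1.
- exact: le_trans (Kalpha _ O) BKa.
- exact: le_trans (Kgamma _ O) BKg.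
- exact: s0.
- exact: uB.
- exact: cs.
Qed.

Lemma ward x z :
  gibbs_integral (fun phi => S1 phi x * angular z phi) =
  (x == z)%:R * gibbs_integral (fun phi => SN phi x).
Proof.
have nN := bmeas_mul_weight (bmeas_SN x).
have nA := bmeas_mul_weight (bmeas_mul (bmeas_S1 x) (bmeas_angular z)).
apply/eqP; rewrite -subr_eq0 -[X in _ == X](gibbs_rotation_derivative x z).
rewrite /gibbs_integral -mulNr -integralZ// -integral_add//; last exact: bmeas_mul (bmeas_cst _ _ _) nN.
by apply/eqP/eq_integral_Omega => phi _; rewrite /rotation_derivative; ring.
Qed.

End model.

(** * Weighted bounds on the transverse two-point function *)

Section transverse.
Context (R : realType) (V : finType) (H : sgraph V) (n : nat) (beta h : R).
Context (beta_ge0 : 0 <= beta).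
Implicit Types (phi : config R V n.+2).
Local Notation gibbs_integral := (@gibbs_integral R V H n beta h).

Local Notation nS1 := (@bmeas_S1 R V n).
Local Notation nSN := (@bmeas_SN R V n).
Local Notation ncst := (@bmeas_cst R V n.+2).

Definition transverse x z : R := gibbs_integral (fun phi => S1 phi x * S1 phi z).
Definition transverse_field x z w : R := gibbs_integral (fun phi => S1 phi x * S1 phi z * SN phi w).

Lemma bmeas_S1S1 x z : bmeasurable (fun phi => S1 phi x * S1 phi z).
Proof. exact: bmeas_mul (nS1 x) (nS1 z). Qed.

Lemma bmeas_S1S1SN x z w : bmeasurable (fun phi => S1 phi x * S1 phi z * SN phi w).
Proof. exact: bmeas_mul (bmeas_S1S1 x z) (nSN w). Qed.

Lemma gibbsD f g : bmeasurable f -> bmeasurable g ->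
  gibbs_integral (fun phi => f phi + g phi) = gibbs_integral f + gibbs_integral g.
Proof.
move=> nf ng; rewrite /gibbs_integral -(integral_add (bmeas_mul_weight _ _ _ nf) (bmeas_mul_weight _ _ _ ng)).
by congr config_integral; apply/funext => phi; rewrite mulrDl.
Qed.

Lemma gibbsZ c f : bmeasurable f -> gibbs_integral (fun phi => c * f phi) = c * gibbs_integral f.
Proof.
move=> nf; rewrite /gibbs_integral -(integralZ _ (bmeas_mul_weight _ _ _ nf)).
by congr config_integral; apply/funext => phi; rewrite mulrA.
Qed.

Lemma gibbs_sum (P : pred V) (F : V -> config R V n.+2 -> R) : (forall w, bmeasurable (F w)) ->
  gibbs_integral (fun phi => \sum_(w | P w) F w phi) = \sum_(w | P w) gibbs_integral (F w).
Proof.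
move=> nF; rewrite /gibbs_integral -integral_sum; last first.
  by move=> w _; exact: bmeas_mul_weight.
by congr config_integral; apply/funext => phi; rewrite mulr_suml.
Qed.

Lemma transverse_ge0 x z : 0 <= transverse x z.
Proof.
have -> : transverse x z = gibbs_integral (fun phi => S1 phi x * S1 phi z * 1).
  by congr gibbs_integral; apply/funext => phi; rewrite mulr1.
by apply: gibbs_S1S1_ge0 => //; exact: ncst.
Qed.

(* [gibbs_S1S1_ge0] applied to [1 + SN w] and [1 - SN w]. *)
Lemma norm_transverse_field x z w : `|transverse_field x z w| <= transverse x z.
Proof.
have nS := bmeas_S1S1 x z; have nT := bmeas_S1S1SN x z w.
have nmT : bmeasurable (fun phi => -1 * (S1 phi x * S1 phi z * SN phi w)).
  exact: bmeas_mul (ncst _) nT.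
have nm : bmeasurable (fun phi => -1 * SN phi w) by exact: bmeas_mul (ncst _) (nSN w).
rewrite ler_norml; apply/andP; split.
- rewrite -subr_ge0 opprK addrC /transverse /transverse_field -gibbsD//.
  rewrite (_ : (fun phi => _) = (fun phi => S1 phi x * S1 phi z * (1 + SN phi w))); last first.
    by apply/funext => phi; ring.
  apply: gibbs_S1S1_ge0 => //.
  + exact: bmeas_add (ncst _) (nSN w).
  + move=> phi O; have := norm_SN_le1 w O; rewrite ler_norml => /andP[] ? _; lra.
  + by move=> sigma phi; rewrite SN_flips.
- rewrite -subr_ge0 /transverse /transverse_field -mulN1r -gibbsZ// -gibbsD//.
  rewrite (_ : (fun phi => _) = (fun phi => S1 phi x * S1 phi z * (1 + -1 * SN phi w))); last first.
    by apply/funext => phi; ring.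
  apply: gibbs_S1S1_ge0 => //.
  + exact: bmeas_add (ncst _) nm.
  + move=> phi O; have := norm_SN_le1 w O; rewrite ler_norml => /andP[] _ ?; lra.
  + by move=> sigma phi; rewrite SN_flips.
Qed.

(** The summand over bonds is antisymmetric under exchange of [z] and [w], which makes a summation
    by parts possible. *)
Lemma ward_transverse x z : h * transverse x z +
    beta * \sum_(w | H z w) (transverse_field x z w - transverse_field x w z) =
  (x == z)%:R * gibbs_integral (fun phi => SN phi x).
Proof.
rewrite -ward /transverse /transverse_field.
have nT := bmeas_S1S1SN x.
have nmT w : bmeasurable (fun phi => -1 * (S1 phi x * S1 phi w * SN phi z)).
  exact: bmeas_mul (ncst _) (nT w z).
have nd w : bmeasurable (fun phi =>
    S1 phi x * S1 phi z * SN phi w + -1 * (S1 phi x * S1 phi w * SN phi z)).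
  exact: bmeas_add (nT z w) (nmT w).
rewrite (eq_bigr (fun w => gibbs_integral (fun phi =>
   S1 phi x * S1 phi z * SN phi w + -1 * (S1 phi x * S1 phi w * SN phi z)))); last first.
  by move=> w _; rewrite gibbsD// gibbsZ// mulN1r.
have nsum := @bmeas_sum _ _ _ _ (index_enum V) (fun w => H z w) _ (fun w _ => nd w).
rewrite -gibbs_sum// -(gibbsZ h (bmeas_S1S1 x z)) -(gibbsZ beta nsum).
rewrite -(gibbsD (bmeas_mul (ncst h) (bmeas_S1S1 x z)) (bmeas_mul (ncst beta) nsum)).
congr gibbs_integral; apply/funext => phi; rewrite /angular mulrDr; congr (_ + _).
  by ring.
rewrite mulrCA; congr (_ * _); rewrite mulr_sumr; apply: eq_bigr => w _.
by ring.
Qed.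

Lemma gibbs_SN_le x : `|gibbs_integral (fun phi => SN phi x)| <= gibbs_integral (fun=> 1).
Proof.
have n1 := bmeas_mul_weight H beta h (ncst 1).
have nN := bmeas_mul_weight H beta h (nSN x).
have nm := bmeas_mul (ncst (-1)) n1.
rewrite ler_norml; apply/andP; split.
  rewrite -mulN1r /gibbs_integral -integralZ//; apply: le_integral_Omega => // phi O.
  rewrite mulrA mulr1 ler_wpM2r ?weight_ge0//.
  by have := norm_SN_le1 x O; rewrite ler_norml => /andP[].
apply: le_integral_Omega => // phi O.
rewrite ler_wpM2r ?weight_ge0//.
by have := norm_SN_le1 x O; rewrite ler_norml => /andP[].
Qed.

(* Summation by parts: the Ward identities weighted by [th] only see the
   increments of [th] along the edges. *)
Lemma weighted_ward x (th : V -> R) : h * \sum_z th z * transverse x z =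
  th x * gibbs_integral (fun phi => SN phi x) -
  beta * \sum_z \sum_(w | H z w) (th z - th w) * transverse_field x z w.
Proof.
have e : \sum_z th z * (h * transverse x z +
    beta * \sum_(w | H z w) (transverse_field x z w - transverse_field x w z)) =
    th x * gibbs_integral (fun phi => SN phi x).
  under eq_bigr do rewrite ward_transverse.
  rewrite (bigD1 x)//= eqxx mul1r big1 ?addr0// => z zx.
  by rewrite eq_sym (negPf zx) mul0r mulr0.
have swap : \sum_z \sum_(w | H z w) th w * transverse_field x z w =
    \sum_z \sum_(w | H z w) th z * transverse_field x w z.
  rewrite (exchange_big_dep xpredT)//=; apply: eq_bigr => z _.
  by apply: eq_bigl => w; rewrite adj_sym.
rewrite -e; under [X in _ = X - _]eq_bigr do rewrite mulrDr.
under [X in _ = _ - _ * X]eq_bigr do (under eq_bigr do rewrite mulrBl; rewrite sumrB).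
rewrite big_split /= sumrB swap -sumrB !mulr_sumr.
rewrite -addrA -[LHS]addr0; congr (_ + _).
  by apply: eq_bigr => z _; rewrite mulrCA.
apply/esym/eqP; rewrite subr_eq0; apply/eqP; apply: eq_bigr => z _.
by rewrite mulrCA sumrB mulrBr !mulr_sumr.
Qed.

Lemma weighted_susceptibility x (th : V -> R) (kappa : R) :
  (forall z, 0 <= th z) ->
  (forall z, \sum_(w | H z w) `|th z - th w| <= kappa * th z) ->
  (`|h| - beta * kappa) * \sum_z th z * transverse x z <= th x * gibbs_integral (fun=> 1).
Proof.
move=> th0 thk.
have S0 : 0 <= \sum_z th z * transverse x z.
  by apply: sumr_ge0 => z _; rewrite mulr_ge0 ?transverse_ge0.
(* The weighted sum is nonnegative, so [|h|] times it is the absolute value of the left side of the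
   weighted identity; this treats both signs of [h] at once. *)
rewrite mulrBl lerBlDr -[X in `|h| * X]ger0_norm// -normrM weighted_ward.
rewrite (le_trans (ler_normB _ _))// lerD//.
  by rewrite normrM ger0_norm// ler_wpM2l// gibbs_SN_le.
rewrite normrM ger0_norm// -mulrA ler_wpM2l// mulr_sumr.
rewrite (le_trans (ler_norm_sum _ _ _))//; apply: ler_sum => z _.
rewrite (le_trans (ler_norm_sum _ _ _))// mulrA.
rewrite (le_trans (y := (\sum_(w | H z w) `|th z - th w|) * transverse x z))//; last first.
  by rewrite ler_wpM2r ?transverse_ge0.
rewrite mulr_suml; apply: ler_sum => w _.
by rewrite normrM ler_wpM2l ?norm_transverse_field.
Qed.

Lemma partition_functionE : partition_function H n.+2 beta h = gibbs_integral (fun=> 1).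
Proof. by apply: eq_Rintegral => phi _; rewrite mul1r. Qed.

Lemma spin_expectationE x y :
  spin_expectation H n.+2 beta h (fun phi => comp (spin phi x) 1 * comp (spin phi y) 1) =
  (gibbs_integral (fun=> 1))^-1 * transverse x y.
Proof.
rewrite /spin_expectation partition_functionE; congr (_ * _).
by apply: eq_Rintegral => phi _; rewrite !comp_first.
Qed.

(** Only the term at [y] of the weighted sum is kept; the others are nonnegative. *)
Lemma spin_expectation_le x y (th : V -> R) (kappa : R) :
  (forall z, 0 < th z) ->
  (forall z, \sum_(w | H z w) `|th z - th w| <= kappa * th z) ->
  beta * kappa < `|h| ->
  spin_expectation H n.+2 beta h (fun phi => comp (spin phi x) 1 * comp (spin phi y) 1) <=
  th x / (th y * (`|h| - beta * kappa)).
Proof.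
move=> th0 thk bk; rewrite spin_expectationE.
have hb : 0 < `|h| - beta * kappa by rewrite subr_gt0.
have Z0 : 0 <= gibbs_integral (fun=> 1).
  by apply: integral_ge0_Omega => phi _; rewrite mul1r weight_ge0.
have := weighted_susceptibility x (fun z => ltW (th0 z)) thk.
have : th y * transverse x y <= \sum_z th z * transverse x z.
  rewrite (bigD1 y)//= lerDl; apply: sumr_ge0 => z _.
  by rewrite mulr_ge0 ?transverse_ge0// ltW.
have [Zgt0|Zle0|Z00] := ltgtP 0 (gibbs_integral (fun=> 1)).
- move=> h1 h2; rewrite ler_pdivlMr ?mulr_gt0//.
  rewrite (_ : _ * _ = (`|h| - beta * kappa) * (th y * transverse x y) / gibbs_integral (fun=> 1)); last by ring.
  by rewrite ler_pdivrMr// (le_trans _ h2)// ler_wpM2l// ltW.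
- by rewrite ltNge Z0 in Zle0.
- (* [0^-1 = 0], so the expectation is [0] should the partition function vanish. *)
  by move=> _ _; rewrite -Z00 invr0 mul0r divr_ge0// ?mulr_ge0// ltW.
Qed.

End transverse.

(** * Exponential decay *)

Section truncated_distance.
Context (R : realType) (V : eqType) (G : sgraph V) (x : V).
Local Notation dist := (graph_dist R G x).

Lemma graph_dist_ge0 z : (0 <= dist z)%E.
Proof. by apply: le_ereal_inf_tmp => _ [p _ <-]; rewrite lee_fin. Qed.

Lemma graph_dist_refl : dist x = 0%E.
Proof.
apply/eqP; rewrite eq_le graph_dist_ge0 andbT.
by apply: ereal_inf_lbound; exists [::].
Qed.

Lemma graph_dist_adj z w : G z w -> (dist w <= dist z + 1)%E.
Proof.
move=> zw; rewrite -leeBlDr//; apply: le_ereal_inf_tmp => _ [p [xp pz] <-].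
rewrite leeBlDr//; apply: ereal_inf_lbound; exists (rcons p w).
  by split; rewrite ?last_rcons// rcons_path xp pz.
by rewrite size_rcons -EFinD natr1.
Qed.

(** The minimum is finite, so [fine] loses nothing, and truncation keeps the increments along edges
    within 1. *)
Definition trunc_dist (M : nat) z : R := fine (mine (dist z) M%:R%:E).

Lemma trunc_distE M z : (trunc_dist M z)%:E = mine (dist z) M%:R%:E.
Proof.
rewrite fineK// ge0_fin_numE; first by rewrite gt_min ltry orbT.
by rewrite le_min graph_dist_ge0 lee_fin ler0n.
Qed.

Lemma trunc_dist_refl M : trunc_dist M x = 0.
Proof.
by apply: EFin_inj; rewrite trunc_distE graph_dist_refl min_l// lee_fin.
Qed.

Lemma trunc_dist_adj M z w : G z w -> `|trunc_dist M z - trunc_dist M w| <= 1.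
Proof.
have key a b : G a b -> trunc_dist M b <= trunc_dist M a + 1.
  move=> ab; rewrite -lee_fin EFinD !trunc_distE.
  have [da|da] := leP (dist a) M%:R%:E.
    by rewrite ge_min (graph_dist_adj ab).
  by rewrite ge_min -EFinD lee_fin lerDl ler01 orbT.
move=> zw; rewrite ler_norml; have := key _ _ zw.
have := key w z; rewrite adj_sym => /(_ zw) h1 h2.
by apply/andP; split; lra.
Qed.

End truncated_distance.

Lemma expR_increment (R : realType) (c s t : R) : 0 <= c -> `|s - t| <= 1 ->
  `|expR (c * s) - expR (c * t)| <= (expR c - 1) * expR (c * s).
Proof.
move=> c0 st.
have -> : expR (c * t) = expR (c * (t - s)) * expR (c * s).
  by rewrite -expRD; congr expR; ring.
rewrite -[X in X - _]mul1r -mulrBl normrM [X in _ * X]ger0_norm ?expR_ge0//.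
rewrite ler_wpM2r ?expR_ge0//.
move: st; rewrite ler_norml => /andP[st1 st2].
have e1 : expR (c * (t - s)) <= expR c by rewrite ler_expR ler_piMr//; lra.
(* For the lower side, [1 - expR (c * (t - s)) <= c * (s - t) <= c <= expR c - 1]. *)
have e2 := expR_ge1Dx (c * (t - s)); have e3 := expR_ge1Dx c.
have : c * (s - t) <= c by rewrite ler_piMr//; lra.
by move=> e4; rewrite ler_norml; apply/andP; split; lra.
Qed.

(** Enumerating the neighbours of [z] in the finite graph injects an initial segment of the naturals
    into its neighbours in [G]. *)
Lemma card_neighbours (V : choiceType) (G : sgraph V) (K : fin_subgraph G)
    (D : nat) (z : verts K) : ([set y | G (val z) y] #<= `I_D)%card ->
  (#|[pred w | K z w]| <= D)%N.
Proof.
move=> GD; rewrite -card_le_II; apply: card_le_trans GD.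
pose nbr i := val (nth z (enum [pred w | K z w]) i).
have inj_nbr : {in `I_#|[pred w | K z w]| &, injective nbr}.
  move=> i j /set_mem /= i_lt /set_mem /= j_lt /val_inj /eqP.
  by rewrite nth_uniq -?cardE ?enum_uniq// => /eqP.
rewrite -(card_le_eql (inj_card_eq inj_nbr)); apply: subset_card_le => _ [i /= i_lt <-].
apply: subgr_sub; have : nth z (enum [pred w | K z w]) i \in [pred w | K z w].
  by rewrite -mem_enum mem_nth// -cardE.
by rewrite inE.
Qed.

(** Since [expR t >= 1 + t], a positive [a] is contradicted as soon as [a * c * M] exceeds [b]. *)
Lemma expR_decay_le0 (R : realType) (a b c : R) : 0 < c -> 0 < b ->
  (forall M : nat, a <= b * expR (- (c * M%:R))) -> a <= 0.
Proof.
move=> c0 b0 H; rewrite leNgt; apply/negP => a0.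
pose M := Num.bound (b / (a * c)).
have bM : b < a * c * M%:R.
  have ac : 0 < a * c by rewrite mulr_gt0.
  by rewrite mulrC -ltr_pdivrMr// archi_boundP// divr_ge0// ltW.
have := H M; rewrite expRN ler_pdivlMr ?expR_gt0//.
rewrite leNgt => /negP; apply.
have := expR_ge1Dx (c * M%:R) => e.
have : a * (1 + c * M%:R) <= a * expR (c * M%:R) by rewrite ler_wpM2l// ltW.
by rewrite mulrDr mulr1 mulrA; lra.
Qed.

(** A finite [d] lies below some [M], where the truncation has no effect. For [d = +oo] the
    truncated value is [M] itself; letting [M] grow gives [a <= 0], which is the claim because the
    right side is then 0. *)
Lemma ereal_decay (R : realType) (a b c : R) (d : \bar R) :
  0 < c -> 0 < b -> (0 <= d)%E ->
  (forall M : nat, a <= b * expR (- (c * fine (mine d M%:R%:E)))) ->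
  (a%:E <= b%:E * expeR (- (c%:E * d)))%E.
Proof.
move=> c0 b0; case: d => [r|_|//] /=.
- rewrite lee_fin => r0 /(_ (Num.bound r)).
  rewrite min_l /= ?lee_fin//; last by rewrite ltW// archi_boundP.
- move=> H; rewrite gt0_muley ?lte_fin//= mule0 lee_fin.
  exact: expR_decay_le0 c0 b0 H.
Qed.

(* Only the bound [c0 = O(h^2)] needs the cap [h ^+ 2]. *)
Definition decay_rate (R : realType) (D : nat) (beta h : R) : R :=
  Num.min (ln (1 + `|h| / (2 * (beta * D%:R + 1)))) (h ^+ 2).

Lemma decay_rate_gt0 (R : realType) D (beta h : R) : 0 <= beta -> h != 0 ->
  0 < decay_rate D beta h.
Proof.
move=> b0 h0; rewrite lt_min exprn_even_gt0//= h0 andbT ln_gt0// ltrDl.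
by rewrite divr_gt0 ?normr_gt0// mulr_gt0// ltr_wpDl// mulr_ge0.
Qed.

(** The logarithm in the rate gives [expR c - 1 <= |h| / (2 * (beta * D + 1))] for [c] the rate. The
    [+ 1] keeps the denominator positive when [beta] or [D] vanishes, and the 2 leaves half of [|h|]
    as slack. *)
Lemma decay_rate_small (R : realType) D (beta h : R) : 0 <= beta ->
  beta * (D%:R * (expR (decay_rate D beta h) - 1)) <= `|h| / 2.
Proof.
move=> b0.
have d0 : 0 < beta * D%:R + 1 by rewrite ltr_wpDl// mulr_ge0.
have q0 : 0 <= `|h| / (2 * (beta * D%:R + 1)).
  by rewrite divr_ge0// mulr_ge0// ltW.
have : expR (decay_rate D beta h) <= 1 + `|h| / (2 * (beta * D%:R + 1)).
  rewrite -[leRHS]lnK ?posrE ?ltr_wpDr// ler_expR.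
  by rewrite ge_min lexx.
rewrite -lerBlDl => e; rewrite mulrA.
rewrite (le_trans (ler_wpM2l (mulr_ge0 b0 (ler0n _ D)) e))//.
have -> : beta * D%:R * (`|h| / (2 * (beta * D%:R + 1))) =
    `|h| / 2 * (beta * D%:R / (beta * D%:R + 1)) by field; rewrite gt_eqF.
rewrite ler_piMr ?divr_ge0// ler_pdivrMr// mul1r; lra.
Qed.

Theorem theorem1p1 (R : realType) (V : choiceType) (G : sgraph V)
    (Vinf : infinite_set [set: V]) (Gbdd : bounded_degree G)
    (beta : R) (beta_ge0 : 0 <= beta) (N : nat) (N_ge2 : (2 <= N)%N) :
  exists c0 C0 : R -> R,
    (forall h : R, h != 0 ->
      [/\ 0 < c0 h, 0 < C0 h &
        forall (GL : nat -> fin_subgraph G) (L : nat) (x y : verts (GL L)),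
          ((spin_expectation (GL L) N beta h
              (fun phi => comp (spin phi x) 1 * comp (spin phi y) 1))%:E
           <= (C0 h)%:E *
              expeR (- ((c0 h)%:E * graph_dist R G (val x) (val y))))%E]) /\
    c0 =O_ (0^') (fun h : R => h ^+ 2).
Proof.
case: N N_ge2 => [|[|n]]// _.
have [D GD] := Gbdd.
(* The prefactor is the inverse of the slack [|h| - |h| / 2]. *)
exists (decay_rate D beta), (fun h => 2 / `|h|); split; last first.
  apply/eqOP; near=> k; near=> h.
  rewrite ger0_norm; last first.
    rewrite le_min sqr_ge0 andbT ln_ge0// lerDl divr_ge0//.
    by rewrite mulr_ge0// addr_ge0// mulr_ge0.
  rewrite (le_trans (y := h ^+ 2))//; first by rewrite ge_min lexx orbT.
  by rewrite [X in _ * X]ger0_norm ?sqr_ge0// ler_peMl// sqr_ge0.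
move=> h h0; have c0 := decay_rate_gt0 D beta_ge0 h0.
have hn : 0 < `|h| by rewrite normr_gt0.
split=> [//||GL L x y]; first by rewrite divr_gt0.
set K := GL L; set c := decay_rate D beta h in c0 *.
apply: ereal_decay => //; [by rewrite divr_gt0|exact: graph_dist_ge0|move=> M].
(* The distance is the one of [G], not of the finite graph; edges of [K] are edges of [G], and the
   weight is 1 at [x]. *)
pose th (z : verts K) : R := expR (c * trunc_dist R G (val x) M (val z)).
have thD z : \sum_(w | K z w) `|th z - th w| <= D%:R * (expR c - 1) * th z.
  rewrite (le_trans (y := \sum_(w | K z w) (expR c - 1) * th z))//.
    apply: ler_sum => w zw; apply: expR_increment; first exact: ltW.
    exact/trunc_dist_adj/subgr_sub.
  rewrite sumr_const -[leLHS]mulr_natl mulrA ler_wpM2r ?expR_ge0// ler_wpM2r//.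
    by rewrite subr_ge0 -expR0 ler_expR ltW.
  by rewrite ler_nat; exact: card_neighbours.
have small := decay_rate_small D h beta_ge0.
have th0 z : 0 < th z by exact: expR_gt0.
have slack : beta * (D%:R * (expR c - 1)) < `|h| by apply: le_lt_trans small _; lra.
apply: (le_trans (spin_expectation_le n beta_ge0 x y th0 thD slack)).
rewrite /th trunc_dist_refl mulr0 expR0 mul1r invfM mulrC expRN.
rewrite ler_wpM2r ?invr_ge0 ?expR_ge0//.
rewrite -[leRHS]invf_div lef_pV2 ?posrE ?divr_gt0//; last by lra.
by lra.
Unshelve. all: by end_near. Qed.
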